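(* Let $\mathcal V\subset\mathbb R^{n_1+n_2+2}$ be a compact set such that every $h=(X,W,(s_{1,j}),(s_{2,j}))\in\mathcal V$ satisfies $X\in A$, $W\in B$, $s_{i,j}\in C$, where $A\subset(0,1)$, $B\subset\mathbb R$, $C\subset(0,\infty)$ are compact. Then for each $T>0$ there exist constants $K>0$ and $\varepsilon_0>0$ such that for all $\varepsilon\in(0,\varepsilon_0]$ and all initial conditions of the hard core piston system with $h_\varepsilon(0)\in\mathcal V$, \[ \sup_{0\le \tau\le T\wedge T_\varepsilon}\bigl|h_\varepsilon(\tau/\varepsilon)-\bar h(\tau)\bigr|\le K\varepsilon . \] That is, the supremum over such initial conditions of $\sup_{0\le\tau\le T\wedge T_\varepsilon}|h_\varepsilon(\tau/\varepsilon)-\bar h(\tau)|$ is $\mathcal O(\varepsilon)$ as $\varepsilon=M^{-1/2}\to0$.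
   Context: Hard core piston system: fix integers $n_1,n_2\ge1$ and masses $m_{1,j}>0$ ($1\le j\le n_1$), $m_{2,j}>0$ ($1\le j\le n_2$). A piston, a point particle of mass $M$ with position $X\in(0,1)$ and velocity $V=dX/dt$, moves in the unit interval $[0,1]$. To its left are $n_1$ point gas particles with positions $x_{1,j}\in[0,X]$, velocities $v_{1,j}$, masses $m_{1,j}$; to its right are $n_2$ point gas particles with positions $x_{2,j}\in[X,1]$, velocities $v_{2,j}$, masses $m_{2,j}$. Gas particles do not interact with each other; between collisions all particles move with constant velocity; gas particles collide elastically with fixed walls at $0$ and $1$ (velocity reversal) and elastically with the piston (collision of point masses $m_{i,j}$ and $M$ conserving momentum and kinetic energy). Simultaneous collisions of several gas particles with the piston are resolved as consecutive instantaneous collisions in a fixed order (left-side particles before right-side particles). Set $\varepsilon=M^{-1/2}$, $W=V/\varepsilon$ (so $dX/dt=\varepsilon W$), and $s_{i,j}=|v_{i,j}|$. The slow variables are $h=(X,W,s_{1,1},\dots,s_{1,n_1},s_{2,1},\dots,s_{2,n_2})\in\mathbb R^{n_1+n_2+2}$, and $h_\varepsilon(t)$ denotes their value at time $t$ along the motion with $M=\varepsilon^{-2}$ from a given initial condition. The averaged vector field $\bar H$ on $\mathbb R^{n_1+n_2+2}$ is \[ \frac{dX}{d\tau}=W,\quad \frac{dW}{d\tau}=\frac{\sum_{j=1}^{n_1}m_{1,j}s_{1,j}^2}{X}-\frac{\sum_{j=1}^{n_2}m_{2,j}s_{2,j}^2}{1-X},\quad \frac{ds_{1,j}}{d\tau}=-\frac{s_{1,j}W}{X},\quad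 \frac{ds_{2,j}}{d\tau}=\frac{s_{2,j}W}{1-X}, \] and $\bar h(\tau)$ denotes the solution of $d\bar h/d\tau=\bar H(\bar h)$ with $\bar h(0)=h_\varepsilon(0)$. The stopping time is $T_\varepsilon=\inf\{\tau\ge0:\bar h(\tau)\notin\mathcal V\text{ or }h_\varepsilon(\tau/\varepsilon)\notin\mathcal V\}$. *)

(* Defs.v *)
From HB Require Import structures.
From mathcomp Require Import all_boot all_order all_algebra.
From mathcomp Require Import all_classical all_reals all_analysis.
Set Implicit Arguments. Unset Strict Implicit. Unset Printing Implicit Defensive.
Import Order.TTheory GRing.Theory Num.Theory.
Import numFieldNormedType.Exports.
Local Open Scope ring_scope.

(** A configuration of the piston system: a piston coordinate and the
    coordinates of the n1 left and n2 right gas particles.  Used both for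
    positions (X, x_{1,j}, x_{2,j}) and for velocities (V, v_{1,j}, v_{2,j}). *)
Record cfg (R : realType) (n1 n2 : nat) :=
  Cfg { cX : R; c1 : 'I_n1 -> R; c2 : 'I_n2 -> R }.

Definition advance (R : realType) (n1 n2 : nat) (p u : cfg R n1 n2) (dt : R)
  : cfg R n1 n2 :=
  Cfg (cX p + dt * cX u) (fun j => c1 p j + dt * c1 u j)
      (fun j => c2 p j + dt * c2 u j).

(** elastic collision of point masses m (velocity v) and M (velocity V):
    returns (v', V') *)
Definition collide (R : realType) (m M v V : R) : R * R :=
  (((m - M) * v + 2 * M * V) / (m + M), ((M - m) * V + 2 * m * v) / (m + M)).

Definition upd (R : realType) (n : nat) (f : 'I_n -> R) (j : 'I_n) (a : R) :=
  fun k => if k == j then a else f k.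

Definition wall (R : realType) (n1 n2 : nat) (p u : cfg R n1 n2) : cfg R n1 n2 :=
  Cfg (cX u)
    (fun j => if (c1 p j == 0) && (c1 u j < 0) then - c1 u j else c1 u j)
    (fun j => if (c2 p j == 1) && (0 < c2 u j) then - c2 u j else c2 u j).

Definition pass (R : realType) (n1 n2 : nat) (m1 : 'I_n1 -> R) (m2 : 'I_n2 -> R)
  (M : R) (p u : cfg R n1 n2) : cfg R n1 n2 :=
  let st1 := foldl (fun (st : R * ('I_n1 -> R)) j =>
       let: (V, v) := st in
       if (c1 p j == cX p) && (V < v j) then
         let: (a, b) := collide (m1 j) M (v j) V in (b, upd v j a)
       else st) (cX u, c1 u) (enum 'I_n1) in
  let st2 := foldl (fun (st : R * ('I_n2 -> R)) j =>
       let: (V, v) := st in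
       if (c2 p j == cX p) && (v j < V) then
         let: (a, b) := collide (m2 j) M (v j) V in (b, upd v j a)
       else st) (st1.1, c2 u) (enum 'I_n2) in
  Cfg st2.1 st1.2 st2.2.

(** resolution of all collisions occurring at one instant: wall reflections,
    then passes of consecutive piston collisions until no gas particle at the
    piston is approaching it.  [resolve p w u]: the pre-collision velocities
    w at positions p become the post-collision velocities u. *)
Definition resolve (R : realType) (n1 n2 : nat) (m1 : 'I_n1 -> R)
  (m2 : 'I_n2 -> R) (M : R) (p w u : cfg R n1 n2) : Prop :=
  exists k : nat, u = iter k (pass m1 m2 M p) (wall p w) /\ pass m1 m2 M p u = u.

Definition in_phase (R : realType) (n1 n2 : nat) (p : cfg R n1 n2) : Prop :=
  (0 < cX p < 1) /\ (forall j, 0 <= c1 p j <= cX p) /\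
  (forall j, cX p <= c2 p j <= 1).

(** [pos], [vel] : time -> configuration is the motion of the hard core piston
    system (piston mass M) on the time interval [0, tmax), starting from
    positions x0 and (pre-collision) velocities u0.  Velocities are
    right-continuous, locally piecewise constant; positions are continuous and
    move linearly with the velocities; at every instant the velocities are the
    collision resolution of the left-limit velocities. *)
Definition is_motion (R : realType) (n1 n2 : nat) (m1 : 'I_n1 -> R)
  (m2 : 'I_n2 -> R) (M : R) (x0 u0 : cfg R n1 n2) (tmax : R)
  (pos vel : R -> cfg R n1 n2) : Prop :=
  pos 0 = x0 /\
  forall t, 0 <= t < tmax ->
    in_phase (pos t) /\
    exists d : R, 0 < d /\ exists w : cfg R n1 n2,
      (t = 0 -> w = u0) /\
      resolve m1 m2 M (pos t) w (vel t) /\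
      (forall s, t - d < s < t -> 0 <= s ->
         vel s = w /\ pos s = advance (pos t) w (s - t)) /\
      (forall s, t <= s < t + d -> s < tmax ->
         vel s = vel t /\ pos s = advance (pos t) (vel t) (s - t)).

Definition idxX (n1 n2 : nat) : 'I_(2 + n1 + n2) := lshift n2 (lshift n1 (@ord0 1)).
Definition idxW (n1 n2 : nat) : 'I_(2 + n1 + n2) := lshift n2 (lshift n1 (@ord_max 1)).
Definition idx1 (n1 n2 : nat) (j : 'I_n1) : 'I_(2 + n1 + n2) := lshift n2 (rshift 2 j).
Definition idx2 (n1 n2 : nat) (j : 'I_n2) : 'I_(2 + n1 + n2) := rshift (2 + n1) j.

Definition hvec (R : realType) (n1 n2 : nat) (X W : R) (s1 : 'I_n1 -> R)
  (s2 : 'I_n2 -> R) : 'rV[R]_(2 + n1 + n2) :=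
  row_mx (row_mx (\row_(i < 2) (if i == ord0 then X else W)) (\row_(j < n1) s1 j))
         (\row_(j < n2) s2 j).

(** slow variables of a state, with eps = M^(-1/2), W = V / eps, s = |v| *)
Definition slow (R : realType) (n1 n2 : nat) (eps : R) (p u : cfg R n1 n2)
  : 'rV[R]_(2 + n1 + n2) :=
  hvec (cX p) (cX u / eps) (fun j => `|c1 u j|) (fun j => `|c2 u j|).

Definition Hbar (R : realType) (n1 n2 : nat) (m1 : 'I_n1 -> R) (m2 : 'I_n2 -> R)
  (h : 'rV[R]_(2 + n1 + n2)) : 'rV[R]_(2 + n1 + n2) :=
  let X := h 0 (idxX n1 n2) in
  let W := h 0 (idxW n1 n2) in
  let s1 := fun j => h 0 (idx1 n2 j) in
  let s2 := fun j => h 0 (idx2 n1 j) in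
  hvec W ((\sum_(j < n1) m1 j * s1 j ^+ 2) / X - (\sum_(j < n2) m2 j * s2 j ^+ 2) / (1 - X))
       (fun j => - (s1 j * W / X)) (fun j => s2 j * W / (1 - X)).

(* Main.v *)
(* Correct each slow variable by an O(eps) function of the state, so that the
   fast oscillation disappears.  With r = x / X for a left particle and
   r = (1 - x) / (1 - X) for a right one, the quantities
     W + eps * sum m r v   and   |v| - V r sgn v
   drift, between collisions, with speed eps * Hbar(h) + O(eps^2); the first is
   exactly conserved by every collision, and the second by the collisions of its
   own particle, while it changes by at most |Delta V| when another particle
   hits the piston.  The sum of all |Delta V| is controlled by a bounded clock
   function, whose jumps are exactly |Delta V|.  Subtracting the clock from the
   distance between the corrected variables and the averaged solution gives a
   function without upward jumps, to which a Gronwall inequality for right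
   Dini derivatives applies.  At one instant no particle hits the piston twice:
   conservation of energy keeps |V| = O(eps), and after a hit the particle moves
   away at a speed bounded below. *)
Require Import Defs.
From HB Require Import structures.
From mathcomp Require Import all_boot all_order all_algebra.
From mathcomp Require Import all_classical all_reals all_analysis.
From mathcomp Require Import ring lra.
Set Implicit Arguments.
Unset Strict Implicit.
Unset Printing Implicit Defensive.
Import Order.TTheory GRing.Theory Num.Theory.
Import numFieldNormedType.Exports.
Local Open Scope ring_scope.
Local Open Scope classical_set_scope.

(** * Continuous induction and a Gronwall inequality for Dini derivatives *)

(** The supremum of the times up to which [P] holds throughout is reached by the left-hand
    hypothesis, and the right-hand one pushes past it unless it equals [T]. *)
Lemma real_induction (R : realType) (T : R) (P : R -> Prop) :
  0 <= T -> P 0 ->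
  (forall t, 0 <= t < T -> P t ->
     exists2 d, 0 < d & forall s, t < s < t + d -> s <= T -> P s) ->
  (forall t, 0 < t <= T -> (forall s, 0 <= s < t -> P s) -> P t) ->
  P T.
Proof.
move=> T0 P0 Pr Pl.
pose S : set R := [set t | 0 <= t <= T /\ forall s, 0 <= s <= t -> P s].
have S0 : S 0.
  split=> [|s]; first by rewrite lexx T0.
  by rewrite -eq_le => /eqP <-.
have hS : has_sup S by split; [exists 0 | exists T => t [/andP[]]].
have c0 : 0 <= sup S by apply: ub_le_sup => //; exact: hS.2.
have cT : sup S <= T by apply: ge_sup; [exists 0 | move=> t [/andP[]]].
have Pc s : 0 <= s < sup S -> P s.
  case/andP=> s0 /sup_gt -/(_ (ex_intro _ 0 S0)) [t [_ St] st].
  by apply: St; rewrite s0 ltW.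
have PS : P (sup S).
  have [c_gt0|c_le0] := ltP 0 (sup S); first by apply: Pl => //; rewrite c_gt0.
  by have -> : sup S = 0 by apply/eqP; rewrite eq_le c_le0 c0.
have [cltT|] := ltP (sup S) T; last first.
  by move=> Tc; have -> : T = sup S by apply/eqP; rewrite eq_le Tc cT.
have [|d d0 Pd] := Pr (sup S) _ PS; first by rewrite c0.
have [e [e0 ed eT]] : exists e, [/\ 0 < e, e < d & sup S + e <= T].
  exists (Num.min (d / 2) (T - sup S)); split.
  - by rewrite lt_min; apply/andP; split; lra.
  - by rewrite gt_min; apply/orP; left; lra.
  - by rewrite -lerBrDl ge_min lexx orbT.
suff : S (sup S + e).
  by move=> /(ub_le_sup hS.2); rewrite gerDl leNgt e0.
split; first by apply/andP; split; lra.
move=> s /andP[s0 sce]; have [sc|cs|->//] := ltgtP s (sup S).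
  by apply: Pc; rewrite s0.
by apply: Pd; [apply/andP; split|]; lra.
Qed.

(** The function may jump down but not up, so real induction keeps it below an increasing
    exponential barrier. At 0 only semicontinuity is assumed, because the averaged solution is
    differentiated at positive times only. *)
Lemma dini_gronwall (R : realType) (L T : R) (f : R -> R) :
  0 <= L -> 0 <= T -> 0 <= f 0 ->
  (forall eta, 0 < eta -> exists2 d, 0 < d &
     forall s, 0 < s < d -> s <= T -> f s <= f 0 + eta) ->
  (forall t, 0 < t < T -> forall eta, 0 < eta -> exists2 d, 0 < d &
     forall s, t < s < t + d -> s <= T ->
       f s <= f t + (L * f t + eta) * (s - t)) ->
  (forall t, 0 < t <= T -> forall eta, 0 < eta ->
     exists2 s, 0 <= s < t & f t <= f s + eta) ->
  f T <= f 0 * expR (L * T).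
Proof.
move=> L0 T0 f0 fr0 fr fl.
(* The barrier carries a slack [eta], which is sent to 0 here. *)
suff H eta : 0 < eta -> f T <= (f 0 + eta + eta * T) * expR (L * T).
  apply/ler_addgt0Pr => e e0.
  have E0 := expR_gt0 (L * T).
  have D0 : 0 < (1 + T) * expR (L * T) by rewrite mulr_gt0 //; lra.
  apply: le_trans (H _ (divr_gt0 e0 D0)) _.
  rewrite le_eqVlt; apply/orP; left; apply/eqP; field.
  apply/andP; split; apply: lt0r_neq0 => //; lra.
move=> eta0.
pose b t := (f 0 + eta + eta * t) * expR (L * t).
have b_mono s t : 0 <= s -> s <= t -> b s <= b t.
  move=> s0 st; apply: ler_pM; rewrite ?expR_ge0 //; first by nra.
    by rewrite lerD2l ler_wpM2l // ltW.
  by rewrite ler_expR ler_wpM2l.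
apply: (@real_induction R T (fun t => f t <= b t)) => //.
- by rewrite /b !mulr0 expR0; lra.
- move=> t /andP[t0 tT] ft; have [t_gt0|t_le0] := ltP 0 t.
    have [|d d0 Hd] := fr t _ _ eta0; first by rewrite t_gt0.
    exists d => // s /andP[ts sd] sT; apply: le_trans (Hd s _ sT) _.
      by rewrite ts.
    have -> : b s = ((f 0 + eta + eta * t) + eta * (s - t))
                    * expR (L * t) * expR (L * (s - t)).
      by rewrite /b -mulrA -expRD; congr (_ * expR _); ring.
    have E1 : 1 <= expR (L * t).
      by rewrite -[leLHS]expR0 ler_expR mulr_ge0.
    have E2 := expR_ge1Dx (L * (s - t)).
    have s0 : 0 < s - t by lra.
    have Ls : 0 <= L * (s - t) by rewrite mulr_ge0 // ltW.
    have c0 : 0 <= eta * t by rewrite mulr_ge0 // ltW.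
    have c1 : 0 < eta * (s - t) by rewrite mulr_gt0.
    set q := eta * (s - t) in c1 *.
    (* The growth factor [1 + L * (s - t)] is below the exponential, and the new slack [q] is below
       its share of the barrier. *)
    apply: (@le_trans _ _ ((b t + q) * (1 + L * (s - t)))).
      have -> : f t + (L * f t + eta) * (s - t) = f t * (1 + L * (s - t)) + q.
        by rewrite /q; ring.
      have : f t * (1 + L * (s - t)) <= b t * (1 + L * (s - t)).
        by apply: ler_wpM2r => //; lra.
      have := mulr_ge0 (ltW c1) Ls.
      lra.
    apply: ler_pM => //; rewrite ?addr_ge0 ?(ltW c1) //; try lra.
      by rewrite /b mulr_ge0 ?expR_ge0 //; lra.
    rewrite /b; nra.
  have t00 : t = 0 by apply/eqP; rewrite eq_le t0 t_le0.
  have [d d0 Hd] := fr0 _ eta0; exists d => // s.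
  rewrite t00 add0r => sd sT.
  apply: le_trans (Hd s sd sT) _; case/andP: sd => s0 _.
  apply: le_trans (b_mono 0 s (lexx _) (ltW s0)).
  by rewrite /b !mulr0 expR0; lra.
- move=> t tT Pt; apply/ler_addgt0Pr => e e0.
  have [s st fts] := fl t tT e e0.
  apply: le_trans fts _; rewrite lerD2r.
  apply: le_trans (Pt s st) _; case/andP: st => s0 st.
  by apply: b_mono => //; exact: ltW.
Qed.

(** * Explicit estimates from differentiability, continuity and compactness *)

Lemma is_derive_estimate (R : realType) (V : normedModType R) (h : R -> V)
  (t : R) (D : V) (eta : R) :
  is_derive t 1 h D -> 0 < eta ->
  exists2 d, 0 < d & forall s, `|s - t| < d ->
    `|h s - h t - (s - t) *: D| <= eta * `|s - t|.
Proof.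
move=> [hd hD] eta0.
have : (fun k => k^-1 *: ((h \o shift t) (k *: 1) - h t)) @ 0^' --> D.
  by rewrite -hD; exact: hd.
move/cvgr_dist_le => /(_ eta eta0).
rewrite near_withinE => -[d /= d0 Hd]; exists d => // s sd.
have [->|st] := eqVneq s t.
  by rewrite !subrr scale0r subr0 !normr0 mulr0.
have st0 : s - t != 0 by rewrite subr_eq0.
have := Hd (s - t); rewrite /= sub0r normrN => /(_ sd st0).
rewrite [(s - t) *: 1]mulr1 subrK => H.
have -> : h s - h t - (s - t) *: D = - ((s - t) *: (D - (s - t)^-1 *: (h s - h t))).
  by rewrite scalerBr scalerA divff // scale1r opprB.
by rewrite normrN normrZ mulrC ler_wpM2r.
Qed.

Lemma within_continuous_estimate (R : realType) (V : normedModType R)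
  (h : R -> V) (b t eta : R) :
  {within `[0, b[, continuous h} -> 0 <= t < b -> 0 < eta ->
  exists2 d, 0 < d & forall s, 0 <= s < b -> `|s - t| < d ->
    `|h s - h t| <= eta.
Proof.
move=> /subspace_continuousP hc tb eta0.
have := hc t; rewrite /= in_itv /= => /(_ tb).
move/cvgr_dist_le => /(_ eta eta0).
rewrite near_withinE => -[d /= d0 Hd]; exists d => // s sb sd.
have sI : `[0, b[ s by rewrite /= in_itv.
have ts : `|t - s| < d by rewrite distrC.
by rewrite distrC; exact: (Hd s ts sI).
Qed.

Lemma compact_bound (R : realType) (A : set R) :
  compact A -> exists2 G, 1 <= G & forall x, A x -> `|x| <= G.
Proof.
move=> /compact_bounded[N [_ H]].
exists (Num.max 1 (N + 1)); first by rewrite le_max lexx.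
move=> x Ax; apply: (le_trans (H (N + 1) _ x Ax)); first by lra.
by rewrite le_max lexx orbT.
Qed.

(** The minimum on a nonempty compact set is attained, hence positive, and [G] is its inverse raised
    to at least 1. With lower bounds written as [G^-1], a single large number serves for upper and
    lower bounds. *)
Lemma compact_pos_bound (R : realType) (A : set R) (f : R -> R) :
  compact A -> continuous f -> (forall x, A x -> 0 < f x) ->
  exists2 G, 1 <= G & forall x, A x -> G^-1 <= f x.
Proof.
move=> cA cf f0; have [A0|] := pselect (A !=set0); last first.
  move=> A0; exists 1 => // x Ax; case: A0; by exists x.
have cfA : {within A, continuous f} by exact: continuous_subspaceT.
have [c /set_mem Ac fc] := compact_EVT_min A0 cA cfA.
exists (Num.max 1 (f c)^-1); first by rewrite le_max lexx.
move=> x Ax; apply: le_trans (fc x (mem_set Ax)).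
rewrite -[leRHS]invrK lef_pV2 ?posrE ?lt_max ?ltr01 ?invr_gt0 ?f0 //.
by rewrite le_max lexx orbT.
Qed.

(** * Corrected slow variables, clock and energy *)

(** Distance to the wall in units of the current chamber width: 0 at the wall, 1 at the piston. *)
Definition rel1 {R : realType} {n1 n2 : nat} (p : cfg R n1 n2) (j : 'I_n1) : R :=
  c1 p j / cX p.

Definition rel2 {R : realType} {n1 n2 : nat} (p : cfg R n1 n2) (j : 'I_n2) : R :=
  (1 - c2 p j) / (1 - cX p).

Definition mom1 {R : realType} {n1 n2 : nat} (m1 : 'I_n1 -> R)
  (p u : cfg R n1 n2) : R := \sum_(j < n1) m1 j * (rel1 p j * c1 u j).

Definition mom2 {R : realType} {n1 n2 : nat} (m2 : 'I_n2 -> R)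
  (p u : cfg R n1 n2) : R := \sum_(j < n2) m2 j * (rel2 p j * c2 u j).

(* The total momentum is eps^-1 (cX u / eps + eps * sum m v); weighting each
   summand by rel1 or rel2 removes the jumps at the walls and keeps the
   conservation at the piston. *)
Definition momW {R : realType} {n1 n2 : nat} (m1 : 'I_n1 -> R) (m2 : 'I_n2 -> R)
  (eps : R) (p u : cfg R n1 n2) : R :=
  cX u / eps + eps * (mom1 m1 p u + mom2 m2 p u).

(* cX p * adia1 is the adiabatic invariant of a left particle: it is constant
   as long as only that particle hits the piston. *)
Definition adia1 {R : realType} {n1 n2 : nat} (p u : cfg R n1 n2) (j : 'I_n1) : R :=
  `|c1 u j| - cX u * (rel1 p j * Num.sg (c1 u j)).

Definition adia2 {R : realType} {n1 n2 : nat} (p u : cfg R n1 n2) (j : 'I_n2) : R :=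
  `|c2 u j| - cX u * (rel2 p j * Num.sg (c2 u j)).

Definition corrected {R : realType} {n1 n2 : nat} (m1 : 'I_n1 -> R)
  (m2 : 'I_n2 -> R) (eps : R) (p u : cfg R n1 n2) : 'rV[R]_(2 + n1 + n2) :=
  hvec (cX p) (momW m1 m2 eps p u) (adia1 p u) (adia2 p u).

(* Jumps up by |Delta cX| at every collision with the piston and drifts at rate
   O(eps^2), so it controls the total variation of the piston velocity. *)
Definition clock {R : realType} {n1 n2 : nat} (m1 : 'I_n1 -> R)
  (m2 : 'I_n2 -> R) (eps : R) (p u : cfg R n1 n2) : R :=
  eps ^+ 2 * (mom2 m2 p u - mom1 m1 p u).

(** Twice the kinetic energy, since [M = eps^-2] turns the piston term into [(cX u / eps) ^+ 2]. *)
Definition energy {R : realType} {n1 n2 : nat} (m1 : 'I_n1 -> R)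
  (m2 : 'I_n2 -> R) (eps : R) (u : cfg R n1 n2) : R :=
  (cX u / eps) ^+ 2 + \sum_(j < n1) m1 j * c1 u j ^+ 2
  + \sum_(j < n2) m2 j * c2 u j ^+ 2.

(** * Elastic collisions and their effect on the corrected variables *)

Lemma collideP {R : realType} (m M v V a b : R) :
  0 < m -> 0 < M -> collide m M v V = (a, b) ->
  [/\ M * (b - V) = - (m * (a - v)), a - b = V - v &
      m * a ^+ 2 + M * b ^+ 2 = m * v ^+ 2 + M * V ^+ 2].
Proof.
move=> m0 M0 [<- <-].
have mM : m + M != 0 by rewrite gt_eqF // addr_gt0.
by split; field.
Qed.

Lemma sum_upd {R : realType} (n : nat) (F : 'I_n -> R -> R) (f : 'I_n -> R)
  (j : 'I_n) (a : R) :
  \sum_(k < n) F k (upd f j a k) = \sum_(k < n) F k (f k) + (F j a - F j (f j)).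
Proof.
rewrite (bigD1 j) //= [in RHS](bigD1 j) //= /upd eqxx.
rewrite (eq_bigr (fun k => F k (f k))); first by ring.
by move=> k /negbTE ->.
Qed.

(* [g] bounds the gas speeds of [w] from below.  After a collision a left
   particle has velocity at most [- g / 2], so it cannot hit again. *)
Definition post_collision {R : realType} {n1 n2 : nat} (m1 : 'I_n1 -> R)
  (m2 : 'I_n2 -> R) (eps g : R) (p w u : cfg R n1 n2) : Prop :=
  [/\ energy m1 m2 eps u = energy m1 m2 eps w,
      momW m1 m2 eps p u = momW m1 m2 eps p w,
      [/\ clock m1 m2 eps p w <= clock m1 m2 eps p u,
          forall j, `|adia1 p u j - adia1 p w j|
                    <= clock m1 m2 eps p u - clock m1 m2 eps p w &
          forall j, `|adia2 p u j - adia2 p w j|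
                    <= clock m1 m2 eps p u - clock m1 m2 eps p w],
      (forall j, c1 u j = c1 w j \/ c1 u j <= - (g / 2)) &
      (forall j, c2 u j = c2 w j \/ g / 2 <= c2 u j)].

(** Meant for the gas particles that do not take part in a collision: their corrected speed sees
    only the jump of the piston velocity, weighted by a factor of modulus at most 1. *)
Lemma norm_adia_diff {R : realType} (s V b r v e : R) :
  0 <= r <= 1 -> `|b - V| <= e ->
  `|(s - b * (r * Num.sg v)) - (s - V * (r * Num.sg v))| <= e.
Proof.
move=> /andP[r0 r1] He.
have -> : (s - b * (r * Num.sg v)) - (s - V * (r * Num.sg v))
        = - ((b - V) * (r * Num.sg v)) by ring.
rewrite normrN normrM; apply: le_trans He.
rewrite -[leRHS]mulr1 ler_wpM2l // normrM (ger0_norm r0) normr_sg.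
by case: (v != 0); rewrite ?mulr1 ?mulr0.
Qed.

Lemma rel1_in01 {R : realType} {n1 n2 : nat} (p : cfg R n1 n2) j :
  in_phase p -> 0 <= rel1 p j <= 1.
Proof.
move=> [/andP[X0 X1] [/(_ j)/andP[x0 xX] _]]; rewrite /rel1.
by rewrite divr_ge0 ?(ltW X0) //= ler_pdivrMr // mul1r.
Qed.

Lemma rel2_in01 {R : realType} {n1 n2 : nat} (p : cfg R n1 n2) j :
  in_phase p -> 0 <= rel2 p j <= 1.
Proof.
move=> [/andP[X0 X1] [_ /(_ j)/andP[xX x1]]]; rewrite /rel2.
have Y0 : 0 < 1 - cX p by lra.
by rewrite divr_ge0 ?(ltW Y0) ?ler_pdivrMr //=; lra.
Qed.

(** Contact means [rel1 = 1], so conservation of momentum is conservation of [momW], and it makes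
    the clock rise by exactly [b - V]. The energy bound [en] limits the piston speed by [dl], at
    most a quarter of the gas speed, both before and after the collision. *)
Lemma collide_left {R : realType} {n1 n2 : nat} (m1 : 'I_n1 -> R)
  (m2 : 'I_n2 -> R) (eps g dl : R) (p w : cfg R n1 n2) (j : 'I_n1)
  (V a b : R) (v1 : 'I_n1 -> R) (v2 : 'I_n2 -> R) :
  (forall j, 0 < m1 j) -> 0 < eps -> 0 < g -> 4 * dl <= g -> in_phase p ->
  (forall u, energy m1 m2 eps u = energy m1 m2 eps w -> `|cX u| <= dl) ->
  g <= `|c1 w j| ->
  c1 p j = cX p -> V < v1 j -> collide (m1 j) (eps ^- 2) (v1 j) V = (a, b) ->
  post_collision m1 m2 eps g p w (Cfg V v1 v2) ->
  post_collision m1 m2 eps g p w (Cfg b (upd v1 j a) v2).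
Proof.
move=> m1_gt0 e0 g0 dg ph en wj pj Vv hc [hE hW [hA0 hA1 hA2] hL hR].
have M0 : 0 < eps ^- 2 by rewrite invr_gt0 exprn_gt0.
have [dp rv ke] := collideP (m1_gt0 j) M0 hc.
have mj := m1_gt0 j.
have eN : eps != 0 by rewrite gt_eqF.
have db : b - V = - (eps ^+ 2 * (m1 j * (a - v1 j))).
  by rewrite -[LHS](mulKf (expf_neq0 2 eN)) -mulrN -dp; field.
have r1 : rel1 p j = 1.
  by rewrite /rel1 pj divff // gt_eqF //; case: ph => /andP[].
have /= := en _ hE; rewrite ler_norml => /andP[V1 V2].
(* A particle already hit would have velocity at most [- (g / 2)], below the piston velocity,
   against [Vv]. So it still has its velocity from [w], and the sign is forced. *)
have vg : g <= v1 j.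
  have /= [vw|] := hL j; last lra.
  by move: wj; rewrite -vw ler_normr => /orP[]; lra.
have E' : energy m1 m2 eps (Cfg b (upd v1 j a) v2) = energy m1 m2 eps w.
  rewrite -hE /energy /= (sum_upd (fun k x => m1 k * x ^+ 2)) !expr_div_n.
  have : b ^+ 2 / eps ^+ 2 = m1 j * v1 j ^+ 2 + V ^+ 2 / eps ^+ 2 - m1 j * a ^+ 2.
    by rewrite [_ / _]mulrC [V ^+ 2 / _]mulrC -ke; ring.
  by move=> ->; ring.
have /= := en _ E'; rewrite ler_norml => /andP[b1 b2].
(* The relative velocity is reversed: [a = b + V - v1 j], at most [2 * dl - g]. *)
have ag : a <= - (g / 2) by lra.
have bV : V <= b.
  by rewrite -subr_ge0 db -mulrN -mulrN !mulr_ge0 ?sqr_ge0 // ?(ltW mj) //; lra.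
have M1 : mom1 m1 p (Cfg b (upd v1 j a) v2)
          = mom1 m1 p (Cfg V v1 v2) + m1 j * (a - v1 j).
  by rewrite /mom1 /= (sum_upd (fun k x => m1 k * (rel1 p k * x))) r1; ring.
have dclock : clock m1 m2 eps p (Cfg b (upd v1 j a) v2)
              = clock m1 m2 eps p (Cfg V v1 v2) + (b - V).
  by rewrite /clock M1 db /mom2 /=; ring.
have bVn : `|b - V| <= b - V by rewrite ger0_norm // subr_ge0.
have step (x y z : R) : `|y - x| <= b - V ->
    `|x - z| <= clock m1 m2 eps p (Cfg V v1 v2) - clock m1 m2 eps p w ->
    `|y - z| <= clock m1 m2 eps p (Cfg b (upd v1 j a) v2) - clock m1 m2 eps p w.
  move=> h1 h2; have -> : y - z = (y - x) + (x - z) by ring.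
  by apply: le_trans (ler_normD _ _) _; rewrite dclock; lra.
split => //.
- rewrite -hW /momW M1 /= /mom2 /=.
  have -> : b = V - eps ^+ 2 * (m1 j * (a - v1 j)) by rewrite -db; ring.
  by field.
- split=> [|k|k]; first by rewrite dclock; lra.
    apply: (step _ _ _ _ (hA1 k)); rewrite /adia1 /= /upd.
    have [->|_] := eqVneq k j; last by apply: norm_adia_diff => //; exact: rel1_in01.
    (* For the particle that is hit, the corrected speed at contact is the relative speed
       [v1 j - V], which the collision turns into the equal value [b - a]. *)
    rewrite r1 (ltr0_sg (_ : a < 0)) ?(gtr0_sg (_ : 0 < v1 j)); try lra.
    rewrite (ltr0_norm (_ : a < 0)) ?(gtr0_norm (_ : 0 < v1 j)); try lra.
    by rewrite (_ : _ - _ = 0) ?normr0 ?subr_ge0 //; lra.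
  by apply: (step _ _ _ _ (hA2 k)); apply: norm_adia_diff => //; exact: rel2_in01.
- move=> k /=; rewrite /upd; have [->|_] := eqVneq k j; first by right.
  exact: hL.
Qed.

(** Mirror image of the left case: the piston slows down, and the opposite sign of [mom2] in the
    clock makes the clock rise by [V - b], again the size of the jump. *)
Lemma collide_right {R : realType} {n1 n2 : nat} (m1 : 'I_n1 -> R)
  (m2 : 'I_n2 -> R) (eps g dl : R) (p w : cfg R n1 n2) (j : 'I_n2)
  (V a b : R) (v1 : 'I_n1 -> R) (v2 : 'I_n2 -> R) :
  (forall j, 0 < m2 j) -> 0 < eps -> 0 < g -> 4 * dl <= g -> in_phase p ->
  (forall u, energy m1 m2 eps u = energy m1 m2 eps w -> `|cX u| <= dl) ->
  g <= `|c2 w j| ->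
  c2 p j = cX p -> v2 j < V -> collide (m2 j) (eps ^- 2) (v2 j) V = (a, b) ->
  post_collision m1 m2 eps g p w (Cfg V v1 v2) ->
  post_collision m1 m2 eps g p w (Cfg b v1 (upd v2 j a)).
Proof.
move=> m2_gt0 e0 g0 dg ph en wj pj Vv hc [hE hW [hA0 hA1 hA2] hL hR].
have M0 : 0 < eps ^- 2 by rewrite invr_gt0 exprn_gt0.
have [dp rv ke] := collideP (m2_gt0 j) M0 hc.
have mj := m2_gt0 j.
have eN : eps != 0 by rewrite gt_eqF.
have db : b - V = - (eps ^+ 2 * (m2 j * (a - v2 j))).
  by rewrite -[LHS](mulKf (expf_neq0 2 eN)) -mulrN -dp; field.
have r1 : rel2 p j = 1.
  by rewrite /rel2 pj divff // gt_eqF //; case: ph => /andP[? ?] _; lra.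
have /= := en _ hE; rewrite ler_norml => /andP[V1 V2].
have vg : v2 j <= - g.
  have /= [vw|] := hR j; last lra.
  by move: wj; rewrite -vw ler_normr => /orP[]; lra.
have E' : energy m1 m2 eps (Cfg b v1 (upd v2 j a)) = energy m1 m2 eps w.
  rewrite -hE /energy /= (sum_upd (fun k x => m2 k * x ^+ 2)) !expr_div_n.
  have : b ^+ 2 / eps ^+ 2 = m2 j * v2 j ^+ 2 + V ^+ 2 / eps ^+ 2 - m2 j * a ^+ 2.
    by rewrite [_ / _]mulrC [V ^+ 2 / _]mulrC -ke; ring.
  by move=> ->; ring.
have /= := en _ E'; rewrite ler_norml => /andP[b1 b2].
have ag : g / 2 <= a by lra.
have bV : b <= V.
  by rewrite -subr_le0 db oppr_le0 !mulr_ge0 ?sqr_ge0 // ?(ltW mj) //; lra.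
have M2 : mom2 m2 p (Cfg b v1 (upd v2 j a))
          = mom2 m2 p (Cfg V v1 v2) + m2 j * (a - v2 j).
  by rewrite /mom2 /= (sum_upd (fun k x => m2 k * (rel2 p k * x))) r1; ring.
have dclock : clock m1 m2 eps p (Cfg b v1 (upd v2 j a))
              = clock m1 m2 eps p (Cfg V v1 v2) + (V - b).
  by rewrite /clock M2 -[V - b]opprB db /mom1 /=; ring.
have bVn : `|b - V| <= V - b by rewrite distrC ger0_norm // subr_ge0.
have step (x y z : R) : `|y - x| <= V - b ->
    `|x - z| <= clock m1 m2 eps p (Cfg V v1 v2) - clock m1 m2 eps p w ->
    `|y - z| <= clock m1 m2 eps p (Cfg b v1 (upd v2 j a)) - clock m1 m2 eps p w.
  move=> h1 h2; have -> : y - z = (y - x) + (x - z) by ring.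
  by apply: le_trans (ler_normD _ _) _; rewrite dclock; lra.
split => //.
- rewrite -hW /momW M2 /= /mom1 /=.
  have -> : b = V - eps ^+ 2 * (m2 j * (a - v2 j)) by rewrite -db; ring.
  by field.
- split=> [|k|k]; first by rewrite dclock; lra.
    by apply: (step _ _ _ _ (hA1 k)); apply: norm_adia_diff => //; exact: rel1_in01.
  apply: (step _ _ _ _ (hA2 k)); rewrite /adia2 /= /upd.
  have [->|_] := eqVneq k j; last by apply: norm_adia_diff => //; exact: rel2_in01.
  rewrite r1 (ltr0_sg (_ : v2 j < 0)) ?(gtr0_sg (_ : 0 < a)); try lra.
  rewrite (ltr0_norm (_ : v2 j < 0)) ?(gtr0_norm (_ : 0 < a)); try lra.
  by rewrite (_ : _ - _ = 0) ?normr0 ?subr_ge0 //; lra.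
- move=> k /=; rewrite /upd; have [->|_] := eqVneq k j; first by right.
  exact: hR.
Qed.

Lemma foldl_inv {S I : Type} (Q : S -> Prop) (f : S -> I -> S) (s : seq I) (x : S) :
  (forall y i, Q y -> Q (f y i)) -> Q x -> Q (foldl f x s).
Proof. by move=> fQ; elim: s x => //= i s IH x Qx; apply/IH/fQ. Qed.

Lemma pass_post_collision {R : realType} {n1 n2 : nat} (m1 : 'I_n1 -> R)
  (m2 : 'I_n2 -> R) (eps g dl : R) (p w u : cfg R n1 n2) :
  (forall j, 0 < m1 j) -> (forall j, 0 < m2 j) ->
  0 < eps -> 0 < g -> 4 * dl <= g -> in_phase p ->
  (forall u, energy m1 m2 eps u = energy m1 m2 eps w -> `|cX u| <= dl) ->
  (forall j, g <= `|c1 w j|) -> (forall j, g <= `|c2 w j|) ->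
  post_collision m1 m2 eps g p w u ->
  post_collision m1 m2 eps g p w (pass m1 m2 (eps ^- 2) p u).
Proof.
move=> hm1 hm2 e0 g0 dg ph en w1 w2 Pu; rewrite /pass.
set st1 := foldl _ (cX u, c1 u) _.
have P1 : post_collision m1 m2 eps g p w (Cfg st1.1 st1.2 (c2 u)).
  apply: (@foldl_inv _ _ (fun st => post_collision m1 m2 eps g p w
                                      (Cfg st.1 st.2 (c2 u)))); last by case: u Pu {st1}.
  move=> [V v] j Pst; cbv beta iota; case: ifP => // /andP[/eqP pj Vv].
  exact: (collide_left hm1 e0 g0 dg ph en (w1 j) pj Vv
           (surjective_pairing (collide _ _ _ _)) Pst).
set st2 := foldl _ (st1.1, c2 u) _.
apply: (@foldl_inv _ _ (fun st => post_collision m1 m2 eps g p w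
                                    (Cfg st.1 st1.2 st.2))) => //.
move=> [V v] j Pst; cbv beta iota; case: ifP => // /andP[/eqP pj Vv].
exact: (collide_right hm2 e0 g0 dg ph en (w2 j) pj Vv
           (surjective_pairing (collide _ _ _ _)) Pst).
Qed.

(** A particle at its wall has relative position 0, so the sign of its velocity enters none of these
    quantities. *)
Lemma wall_invariants {R : realType} {n1 n2 : nat} (m1 : 'I_n1 -> R)
  (m2 : 'I_n2 -> R) (eps : R) (p w : cfg R n1 n2) :
  [/\ energy m1 m2 eps (wall p w) = energy m1 m2 eps w,
      mom1 m1 p (wall p w) = mom1 m1 p w,
      mom2 m2 p (wall p w) = mom2 m2 p w,
      adia1 p (wall p w) =1 adia1 p w & adia2 p (wall p w) =1 adia2 p w].
Proof.
split.
- rewrite /energy /=; congr (_ + _ + _); apply: eq_bigr => j _;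
    by case: ifP; rewrite ?sqrrN.
- apply: eq_bigr => j _ /=; case: ifP => // /andP[/eqP pj _].
  by rewrite /rel1 pj !mul0r.
- apply: eq_bigr => j _ /=; case: ifP => // /andP[/eqP pj _].
  by rewrite /rel2 pj subrr !mul0r.
- move=> j; rewrite /adia1 /=; case: ifP => // /andP[/eqP pj _].
  by rewrite /rel1 pj !mul0r normrN.
- move=> j; rewrite /adia2 /=; case: ifP => // /andP[/eqP pj _].
  by rewrite /rel2 pj subrr !mul0r normrN.
Qed.

(** * Coordinates and norm of slow vectors *)

Lemma hvecX {R : realType} {n1 n2 : nat} (X W : R) (s1 : 'I_n1 -> R)
  (s2 : 'I_n2 -> R) : hvec X W s1 s2 0 (idxX n1 n2) = X.
Proof. by rewrite /hvec /idxX !row_mxEl mxE. Qed.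

Lemma hvecW {R : realType} {n1 n2 : nat} (X W : R) (s1 : 'I_n1 -> R)
  (s2 : 'I_n2 -> R) : hvec X W s1 s2 0 (idxW n1 n2) = W.
Proof. by rewrite /hvec /idxW !row_mxEl mxE. Qed.

Lemma hvec1 {R : realType} {n1 n2 : nat} (X W : R) (s1 : 'I_n1 -> R)
  (s2 : 'I_n2 -> R) j : hvec X W s1 s2 0 (idx1 n2 j) = s1 j.
Proof. by rewrite /hvec /idx1 row_mxEl row_mxEr mxE. Qed.

Lemma hvec2 {R : realType} {n1 n2 : nat} (X W : R) (s1 : 'I_n1 -> R)
  (s2 : 'I_n2 -> R) j : hvec X W s1 s2 0 (idx2 n1 j) = s2 j.
Proof. by rewrite /hvec /idx2 row_mxEr mxE. Qed.

Definition hvecE {R : realType} {n1 n2 : nat} :=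
  (@hvecX R n1 n2, @hvecW R n1 n2, @hvec1 R n1 n2, @hvec2 R n1 n2).

Lemma entryB {R : realType} {n : nat} (u v : 'rV[R]_n) i :
  (u - v) 0 i = u 0 i - v 0 i.
Proof. by rewrite !mxE. Qed.

Lemma entryZ {R : realType} {n : nat} (a : R) (v : 'rV[R]_n) i :
  (a *: v) 0 i = a * v 0 i.
Proof. by rewrite mxE. Qed.

Lemma entry_norm_le {R : realType} {n : nat} (v : 'rV[R]_n) i : `|v 0 i| <= `|v|.
Proof.
rewrite [leRHS]mx_normrE.
by apply: (le_trans _ (le_bigmax _ _ (ord0, i))).
Qed.

(** The norm on row vectors is the maximum norm, so estimates can be made coordinate by
    coordinate. *)
Lemma slow_norm_le {R : realType} {n1 n2 : nat} (v : 'rV[R]_(2 + n1 + n2)) (e : R) :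
  `|v 0 (idxX n1 n2)| <= e -> `|v 0 (idxW n1 n2)| <= e ->
  (forall j, `|v 0 (idx1 n2 j)| <= e) -> (forall j, `|v 0 (idx2 n1 j)| <= e) ->
  `|v| <= e.
Proof.
move=> vX vW v1 v2; rewrite [leLHS]mx_normrE.
apply/bigmax_leP; split=> [|[i j] _ /=]; first exact: le_trans (normr_ge0 _) vX.
rewrite (ord1 i); case: (split_ordP j) => [k ->|k ->]; last exact: v2.
case: (split_ordP k) => [l ->|l ->]; last exact: v1.
case: l => [[|[|//]] l2].
- by move: vX; congr (`|v _ _| <= _); apply: val_inj.
- by move: vW; congr (`|v _ _| <= _); apply: val_inj.
Qed.

(** * All collisions of one instant *)

(** Positions do not change and [momW] is conserved, so only the corrected speeds jump, by at most
    the rise of the clock. The induction on the number of passes starts after the wall reflections,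
    which leave everything unchanged. *)
Lemma resolve_corrected {R : realType} {n1 n2 : nat} (m1 : 'I_n1 -> R)
  (m2 : 'I_n2 -> R) (eps g dl : R) (p w u : cfg R n1 n2) :
  (forall j, 0 < m1 j) -> (forall j, 0 < m2 j) ->
  0 < eps -> 0 < g -> 4 * dl <= g -> in_phase p ->
  (forall u, energy m1 m2 eps u = energy m1 m2 eps w -> `|cX u| <= dl) ->
  (forall j, g <= `|c1 w j|) -> (forall j, g <= `|c2 w j|) ->
  resolve m1 m2 (eps ^- 2) p w u ->
  energy m1 m2 eps u = energy m1 m2 eps w /\
  `|corrected m1 m2 eps p u - corrected m1 m2 eps p w|
    <= clock m1 m2 eps p u - clock m1 m2 eps p w.
Proof.
move=> hm1 hm2 e0 g0 dg ph en w1 w2 [k [-> _]].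
have [hE hM1 hM2 hA1 hA2] := wall_invariants m1 m2 eps p w.
have clockE : clock m1 m2 eps p (wall p w) = clock m1 m2 eps p w.
  by rewrite /clock hM1 hM2.
have WE : momW m1 m2 eps p (wall p w) = momW m1 m2 eps p w.
  by rewrite /momW hM1 hM2.
have : post_collision m1 m2 eps g p (wall p w)
         (iter k (pass m1 m2 (eps ^- 2) p) (wall p w)).
  elim: k => [|k IH] /=.
    split=> //; [|by left|by left].
    by split=> // j; rewrite !subrr normr0.
  apply: (pass_post_collision hm1 hm2 e0 g0 dg ph _ _ _ IH).
  - by move=> v; rewrite hE; exact: en.
  - by move=> j /=; case: ifP; rewrite ?normrN.
  - by move=> j /=; case: ifP; rewrite ?normrN.
case; rewrite hE WE clockE; set u' := iter _ _ _.
move=> E' W' [A0' A1' A2'] _ _; split=> //.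
have d0 : 0 <= clock m1 m2 eps p u' - clock m1 m2 eps p w by rewrite subr_ge0.
apply: slow_norm_le.
- by rewrite entryB !hvecE subrr normr0.
- by rewrite entryB !hvecE W' subrr normr0.
- by move=> j; rewrite entryB !hvecE -hA1.
- by move=> j; rewrite entryB !hvecE -hA2.
Qed.

(** * The box and its constants *)

(** Quantitative form of membership in the compact set; all later constants depend only on [G] and
    the gas masses. *)
Definition in_box {R : realType} {n1 n2 : nat} (G : R) (h : 'rV[R]_(2 + n1 + n2)) :=
  [/\ G^-1 <= h 0 (idxX n1 n2) /\ G^-1 <= 1 - h 0 (idxX n1 n2),
      `|h 0 (idxW n1 n2)| <= G,
      (forall j, G^-1 <= h 0 (idx1 n2 j) <= G) &
      (forall j, G^-1 <= h 0 (idx2 n1 j) <= G)].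

Definition mass {R : realType} {n1 n2 : nat} (m1 : 'I_n1 -> R) (m2 : 'I_n2 -> R) : R :=
  \sum_(j < n1) m1 j + \sum_(j < n2) m2 j.

(* Bounds the energy plus the total mass in the box of size [G]. *)
Definition energy_cst {R : realType} {n1 n2 : nat} (m1 : 'I_n1 -> R)
  (m2 : 'I_n2 -> R) (G : R) : R := 2 * G ^+ 2 * (1 + mass m1 m2).

(** One constant for three purposes: it bounds [Hbar] on the box, is a Lipschitz constant for it
    there, and controls the second-order drift in free flight. *)
Definition drift_cst {R : realType} {n1 n2 : nat} (m1 : 'I_n1 -> R)
  (m2 : 'I_n2 -> R) (G : R) : R := 2 * G ^+ 3 * energy_cst m1 m2 G.

Lemma norm_wsum_le {R : realType} (n : nat) (m F : 'I_n -> R) (e : R) :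
  (forall j, 0 < m j) -> (forall j, `|F j| <= e) ->
  `|\sum_(j < n) m j * F j| <= (\sum_(j < n) m j) * e.
Proof.
move=> m0 Fe; apply: le_trans (ler_norm_sum _ _ _) _.
rewrite mulr_suml; apply: ler_sum => j _.
by rewrite normrM (gtr0_norm (m0 j)) ler_wpM2l ?Fe // ltW.
Qed.

Lemma mass_ge0 {R : realType} (n1 n2 : nat) (m1 : 'I_n1 -> R) (m2 : 'I_n2 -> R) :
  (forall j, 0 < m1 j) -> (forall j, 0 < m2 j) -> 0 <= mass m1 m2.
Proof. by move=> h1 h2; apply: addr_ge0; apply: sumr_ge0 => j _; exact: ltW. Qed.

Lemma rel1_advance {R : realType} {n1 n2 : nat} (p u : cfg R n1 n2) (th : R) j :
  cX p != 0 -> cX (advance p u th) != 0 ->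
  rel1 (advance p u th) j = rel1 p j + th * (c1 u j / cX p)
    - th * (cX u / cX p * rel1 (advance p u th) j).
Proof. by move=> X0 Y0; rewrite /rel1 /= in Y0 *; field; apply/andP. Qed.

Lemma rel2_advance {R : realType} {n1 n2 : nat} (p u : cfg R n1 n2) (th : R) j :
  1 - cX p != 0 -> 1 - cX (advance p u th) != 0 ->
  rel2 (advance p u th) j = rel2 p j - th * (c2 u j / (1 - cX p))
    + th * (cX u / (1 - cX p) * rel2 (advance p u th) j).
Proof. by move=> X0 Y0; rewrite /rel2 /= in Y0 *; field; apply/andP. Qed.

(** The main term is the left pressure in [Hbar], written with speeds to match the slow coordinates;
    the last term carries the small factor [cX u]. *)
Lemma mom1_advance {R : realType} {n1 n2 : nat} (m1 : 'I_n1 -> R)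
  (p u : cfg R n1 n2) (th : R) :
  cX p != 0 -> cX (advance p u th) != 0 ->
  mom1 m1 (advance p u th) u = mom1 m1 p u
    + th * ((\sum_(j < n1) m1 j * `|c1 u j| ^+ 2) / cX p)
    - th * (cX u / cX p * mom1 m1 (advance p u th) u).
Proof.
move=> X0 Y0; rewrite /mom1 mulr_suml !mulr_sumr -big_split -sumrB /=.
apply: eq_bigr => j _; rewrite {1}rel1_advance // real_normK ?num_real //.
by ring.
Qed.

Lemma mom2_advance {R : realType} {n1 n2 : nat} (m2 : 'I_n2 -> R)
  (p u : cfg R n1 n2) (th : R) :
  1 - cX p != 0 -> 1 - cX (advance p u th) != 0 ->
  mom2 m2 (advance p u th) u = mom2 m2 p u
    - th * ((\sum_(j < n2) m2 j * `|c2 u j| ^+ 2) / (1 - cX p))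
    + th * (cX u / (1 - cX p) * mom2 m2 (advance p u th) u).
Proof.
move=> X0 Y0; rewrite /mom2 mulr_suml !mulr_sumr -sumrB -big_split /=.
apply: eq_bigr => j _; rewrite {1}rel2_advance // real_normK ?num_real //.
by ring.
Qed.

(** The linear term in [cX u] is the speed component of [Hbar]; the remainder is quadratic in the
    piston velocity. *)
Lemma adia1_advance {R : realType} {n1 n2 : nat} (p u : cfg R n1 n2) (th : R) j :
  cX p != 0 -> cX (advance p u th) != 0 ->
  adia1 (advance p u th) u j = adia1 p u j - th * (cX u * `|c1 u j| / cX p)
    + th * (cX u ^+ 2 / cX p * (rel1 (advance p u th) j * Num.sg (c1 u j))).
Proof.
move=> X0 Y0; rewrite /adia1 {1}rel1_advance // [in th * (_ * `|_| / _)]normrEsg.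
by ring.
Qed.

Lemma adia2_advance {R : realType} {n1 n2 : nat} (p u : cfg R n1 n2) (th : R) j :
  1 - cX p != 0 -> 1 - cX (advance p u th) != 0 ->
  adia2 (advance p u th) u j = adia2 p u j + th * (cX u * `|c2 u j| / (1 - cX p))
    - th * (cX u ^+ 2 / (1 - cX p) * (rel2 (advance p u th) j * Num.sg (c2 u j))).
Proof.
move=> X0 Y0; rewrite /adia2 {1}rel2_advance // [in th * (_ * `|_| / _)]normrEsg.
by ring.
Qed.

(** * A priori bounds from the energy *)

Lemma norm_rel_sg {R : realType} (r v : R) : 0 <= r <= 1 -> `|r * Num.sg v| <= 1.
Proof.
move=> /andP[r0 r1]; rewrite normrM ger0_norm // normr_sg.
by case: (v != 0); rewrite ?mulr1 ?mulr0.
Qed.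

Lemma mom_le {R : realType} {n1 n2 : nat} (m1 : 'I_n1 -> R) (m2 : 'I_n2 -> R)
  (eps E : R) (p u : cfg R n1 n2) :
  (forall j, 0 < m1 j) -> (forall j, 0 < m2 j) -> in_phase p ->
  energy m1 m2 eps u <= E ->
  `|mom1 m1 p u| + `|mom2 m2 p u| <= mass m1 m2 + E.
Proof.
move=> hm1 hm2 ph hE.
(* From [|v| <= 1 + v^2]: first moments are controlled by mass plus energy. *)
have amgm (m r v : R) : 0 < m -> 0 <= r <= 1 -> `|m * (r * v)| <= m + m * v ^+ 2.
  move=> m0 /andP[r0 r1]; rewrite normrM (gtr0_norm m0) (_ : m + m * v ^+ 2 = m * (1 + v ^+ 2)); last by ring.
  rewrite ler_wpM2l ?(ltW m0) // normrM (ger0_norm r0).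
  have h1 : r * `|v| <= `|v| by rewrite ler_piMl.
  by have := real_normK (num_real v); have := normr_ge0 v; nra.
have h1 : `|mom1 m1 p u| <= \sum_j m1 j + \sum_j m1 j * c1 u j ^+ 2.
  apply: le_trans (ler_norm_sum _ _ _) _; rewrite -big_split /=.
  by apply: ler_sum => j _; apply: amgm => //; exact: rel1_in01.
have h2 : `|mom2 m2 p u| <= \sum_j m2 j + \sum_j m2 j * c2 u j ^+ 2.
  apply: le_trans (ler_norm_sum _ _ _) _; rewrite -big_split /=.
  by apply: ler_sum => j _; apply: amgm => //; exact: rel2_in01.
apply: le_trans (lerD h1 h2) _; rewrite /mass.
by move: hE; rewrite /energy; have := sqr_ge0 (cX u / eps); lra.
Qed.

Lemma piston_speed_le {R : realType} {n1 n2 : nat} (m1 : 'I_n1 -> R)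
  (m2 : 'I_n2 -> R) (eps V : R) (u : cfg R n1 n2) :
  (forall j, 0 < m1 j) -> (forall j, 0 < m2 j) -> 0 < eps -> 0 <= V ->
  energy m1 m2 eps u <= V ^+ 2 -> `|cX u| <= eps * V.
Proof.
move=> hm1 hm2 e0 V0 hE.
have s1 : 0 <= \sum_j m1 j * c1 u j ^+ 2.
  by apply: sumr_ge0 => j _; rewrite mulr_ge0 ?sqr_ge0 // ltW.
have s2 : 0 <= \sum_j m2 j * c2 u j ^+ 2.
  by apply: sumr_ge0 => j _; rewrite mulr_ge0 ?sqr_ge0 // ltW.
have : `|cX u / eps| <= V.
  rewrite -(ger0_norm V0) -ler_sqr ?nnegrE ?normr_ge0 // !real_normK ?num_real //.
  by apply: le_trans hE; rewrite /energy; lra.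
by rewrite normrM normfV (gtr0_norm e0) ler_pdivrMr // mulrC.
Qed.

Lemma box_energy {R : realType} {n1 n2 : nat} (m1 : 'I_n1 -> R)
  (m2 : 'I_n2 -> R) (eps G : R) (p u : cfg R n1 n2) :
  (forall j, 0 < m1 j) -> (forall j, 0 < m2 j) -> 1 <= G ->
  in_box G (slow eps p u) ->
  energy m1 m2 eps u <= G ^+ 2 * (1 + mass m1 m2).
Proof.
move=> hm1 hm2 G1 [_]; rewrite /slow !hvecE => W H1 H2.
have sqle (x : R) : `|x| <= G -> `|x ^+ 2| <= G ^+ 2.
  by move=> xG; rewrite normrX lerXn2r ?nnegrE //; lra.
have h1 : \sum_j m1 j * c1 u j ^+ 2 <= (\sum_j m1 j) * G ^+ 2.
  apply: le_trans (ler_norm _) _; apply: norm_wsum_le => // j.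
  by apply: sqle; have := H1 j; rewrite hvecE => /andP[].
have h2 : \sum_j m2 j * c2 u j ^+ 2 <= (\sum_j m2 j) * G ^+ 2.
  apply: le_trans (ler_norm _) _; apply: norm_wsum_le => // j.
  by apply: sqle; have := H2 j; rewrite hvecE => /andP[].
have h3 : (cX u / eps) ^+ 2 <= G ^+ 2 by apply: le_trans (ler_norm _) (sqle _ W).
by rewrite /energy /mass; lra.
Qed.

(** Collects every comparison of constants used below; each one follows from [1 <= G] and
    nonnegative total mass. *)
Lemma cst_facts {R : realType} (n1 n2 : nat) (m1 : 'I_n1 -> R) (m2 : 'I_n2 -> R)
  (G : R) :
  (forall j, 0 < m1 j) -> (forall j, 0 < m2 j) -> 1 <= G ->
  let S := energy_cst m1 m2 G in
  let K := drift_cst m1 m2 G in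
  [/\ 1 <= S, mass m1 m2 + G ^+ 2 * (1 + mass m1 m2) <= S,
      G * (1 + mass m1 m2) <= S, S <= K &
      [/\ G * S + G ^+ 2 * S <= K, 3 * G ^+ 4 * (1 + mass m1 m2) <= K & G ^+ 3 <= K]].
Proof.
move=> hm1 hm2 G1 S K; have mu0 := mass_ge0 hm1 hm2; set mu := mass m1 m2 in mu0 *.
have SE : S = 2 * G ^+ 2 * (1 + mu) by [].
have KE : K = 2 * G ^+ 3 * S by [].
have G2 : 1 <= G ^+ 2 by rewrite exprn_ege1.
have G12 : G <= G ^+ 2 by rewrite -[leLHS]mulr1 expr2 ler_wpM2l //; lra.
have G3 : 1 <= G ^+ 3 by rewrite exprn_ege1.
have G13 : G <= G ^+ 3 by rewrite -[leLHS]mulr1 exprS ler_wpM2l //; lra.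
have G23 : G ^+ 2 <= G ^+ 3 by rewrite -[leLHS]mul1r exprS ler_wpM2r //; lra.
have mG : mu <= mu * G ^+ 2 by rewrite ler_peMr.
have mG' : mu * G <= mu * G ^+ 2 by rewrite ler_wpM2l.
have S1 : 1 <= S by rewrite SE; lra.
have S0 : 0 <= S by lra.
have GS : G * S <= G ^+ 3 * S by rewrite ler_wpM2r.
have G2S : G ^+ 2 * S <= G ^+ 3 * S by rewrite ler_wpM2r.
have G3S : S <= G ^+ 3 * S by rewrite ler_peMl.
have G3S' : G ^+ 3 <= G ^+ 3 * S by rewrite ler_peMr //; lra.
split; [by []| | | |split]; rewrite ?KE; try lra.
have G45 : G ^+ 4 <= G ^+ 5 by rewrite -[leLHS]mul1r [leRHS]exprS ler_wpM2r ?exprn_ge0 //; lra.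
have G50 : 0 <= G ^+ 5 by rewrite exprn_ge0 //; lra.
have mG45 : mu * G ^+ 4 <= mu * G ^+ 5 by rewrite ler_wpM2l.
have mG5 := mulr_ge0 mu0 G50.
have -> : 2 * G ^+ 3 * S = 4 * G ^+ 5 + 4 * (mu * G ^+ 5) by rewrite SE; ring.
lra.
Qed.

(** * The averaged field and the size of the corrections *)

Lemma quotient_lip {R : realType} (G a b X Y A B d : R) :
  0 < G -> `|a - b| <= A -> `|b| <= B -> `|X - Y| <= d ->
  G^-1 <= X -> G^-1 <= Y -> `|a / X - b / Y| <= A * G + B * G ^+ 2 * d.
Proof.
move=> G0 ab bB XY GX GY.
have Gi : 0 < G^-1 by rewrite invr_gt0.
have X0 : 0 < X by lra.
have Y0 : 0 < Y by lra.
have iX : X^-1 <= G by rewrite -[leRHS]invrK lef_pV2 ?posrE.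
have iY : Y^-1 <= G by rewrite -[leRHS]invrK lef_pV2 ?posrE.
have -> : a / X - b / Y = (a - b) * X^-1 + b * (X^-1 * Y^-1) * (Y - X).
  by field; rewrite !gt_eqF.
apply: le_trans (ler_normD _ _) _; apply: lerD.
  by rewrite normrM (ger0_norm (_ : 0 <= X^-1)) ?ler_pM ?invr_ge0 // ltW.
rewrite !normrM (ger0_norm (_ : 0 <= X^-1)) ?(ger0_norm (_ : 0 <= Y^-1));
  try by rewrite invr_ge0 ltW.
rewrite distrC in XY; rewrite ler_pM ?mulr_ge0 ?invr_ge0 ?(ltW X0) ?(ltW Y0) //.
rewrite ler_pM ?mulr_ge0 ?invr_ge0 ?(ltW X0) ?(ltW Y0) // expr2.
by rewrite ler_pM ?invr_ge0 ?(ltW X0) ?(ltW Y0).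
Qed.

(** Apart from the component [W], the field is built from terms [a * b / X] with factors at most [G]
    and denominators at least [G^-1]. Each has Lipschitz constant [2 * G^2 + G^4], at most
    [3 * G^4], and the pressures add the masses as weights. *)
Lemma Hbar_lip {R : realType} {n1 n2 : nat} (m1 : 'I_n1 -> R) (m2 : 'I_n2 -> R)
  (G : R) (h h' : 'rV[R]_(2 + n1 + n2)) :
  (forall j, 0 < m1 j) -> (forall j, 0 < m2 j) -> 1 <= G ->
  in_box G h -> in_box G h' ->
  `|Hbar m1 m2 h - Hbar m1 m2 h'| <= drift_cst m1 m2 G * `|h - h'|.
Proof.
move=> hm1 hm2 G1 [[X1 X2] W1 L1 R1] [[X1' X2'] W1' L1' R1'].
have [S1 _ _ SK [_ K4 _]] := cst_facts hm1 hm2 G1.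
set S := energy_cst _ _ _ in S1 SK; set K := drift_cst _ _ _ in SK K4 *.
have G0 : 0 < G by lra.
have mu0 := mass_ge0 hm1 hm2.
set d := `|h - h'|.
have d0 : 0 <= d by exact: normr_ge0.
have dl i : `|h 0 i - h' 0 i| <= d by rewrite -entryB; exact: entry_norm_le.
have G24 : G ^+ 2 <= G ^+ 4.
  by rewrite -[leLHS]mul1r (exprD G 2 2) ler_wpM2r ?sqr_ge0 // exprn_ege1.
have G40 : 0 <= G ^+ 4 by rewrite exprn_ge0 // ltW.
have prod_lip (a b a' b' : R) : `|a - a'| <= d -> `|b - b'| <= d ->
    `|a'| <= G -> `|b| <= G -> `|a * b - a' * b'| <= 2 * G * d.
  move=> h1 h2 h3 h4.
  have -> : a * b - a' * b' = (a - a') * b + a' * (b - b') by ring.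
  apply: le_trans (ler_normD _ _) _; rewrite !normrM.
  have := ler_pM (normr_ge0 _) (normr_ge0 _) h1 h4.
  have := ler_pM (normr_ge0 _) (normr_ge0 _) h3 h2.
  by lra.
have prod_bd (a b : R) : `|a| <= G -> `|b| <= G -> `|a * b| <= G ^+ 2.
  by move=> h1 h2; rewrite normrM expr2 ler_pM.
have nb (x : R) : G^-1 <= x <= G -> `|x| <= G.
  have : 0 < G^-1 by rewrite invr_gt0.
  by move=> ? /andP[? ?]; rewrite ger0_norm //; lra.
have quot (a b a' b' X Y : R) : `|a - a'| <= d -> `|b - b'| <= d ->
    `|a'| <= G -> `|b| <= G -> `|b'| <= G -> G^-1 <= X -> G^-1 <= Y ->
    `|X - Y| <= d -> `|a * b / X - a' * b' / Y| <= 3 * G ^+ 4 * d.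
  move=> h1 h2 h3 h4 h5 hX hY hXY.
  apply: le_trans (quotient_lip G0 (prod_lip _ _ _ _ h1 h2 h3 h4)
           (prod_bd _ _ h3 h5) hXY hX hY) _.
  have -> : 2 * G * d * G + G ^+ 2 * G ^+ 2 * d = (2 * G ^+ 2 + G ^+ 4) * d by ring.
  by rewrite ler_wpM2r //; lra.
have K3 : 3 * G ^+ 4 * d <= K * d.
  rewrite ler_wpM2r //; apply: le_trans K4.
  by rewrite ler_peMr //; lra.
have dX2 : `|(1 - h 0 (idxX n1 n2)) - (1 - h' 0 (idxX n1 n2))| <= d.
  by rewrite distrC (_ : _ - _ = h 0 (idxX n1 n2) - h' 0 (idxX n1 n2)) //; ring.
apply: slow_norm_le; rewrite /Hbar.
- by rewrite entryB !hvecE; apply: le_trans (dl _) _; rewrite ler_peMl //; lra.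
- rewrite entryB !hvecE.
  have e1 : `|(\sum_j m1 j * h 0 (idx1 n2 j) ^+ 2) / h 0 (idxX n1 n2)
             - (\sum_j m1 j * h' 0 (idx1 n2 j) ^+ 2) / h' 0 (idxX n1 n2)|
            <= (\sum_j m1 j) * (3 * G ^+ 4 * d).
    have -> : forall X Y : R,
        (\sum_j m1 j * h 0 (idx1 n2 j) ^+ 2) / X - (\sum_j m1 j * h' 0 (idx1 n2 j) ^+ 2) / Y
        = \sum_j m1 j * (h 0 (idx1 n2 j) * h 0 (idx1 n2 j) / X - h' 0 (idx1 n2 j) * h' 0 (idx1 n2 j) / Y).
      by move=> X Y; rewrite !mulr_suml -sumrB; apply: eq_bigr => j _; ring.
    by apply: norm_wsum_le => // j; apply: quot => //; apply: nb.
  have e2 : `|(\sum_j m2 j * h 0 (idx2 n1 j) ^+ 2) / (1 - h 0 (idxX n1 n2))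
             - (\sum_j m2 j * h' 0 (idx2 n1 j) ^+ 2) / (1 - h' 0 (idxX n1 n2))|
            <= (\sum_j m2 j) * (3 * G ^+ 4 * d).
    have -> : forall X Y : R,
        (\sum_j m2 j * h 0 (idx2 n1 j) ^+ 2) / X - (\sum_j m2 j * h' 0 (idx2 n1 j) ^+ 2) / Y
        = \sum_j m2 j * (h 0 (idx2 n1 j) * h 0 (idx2 n1 j) / X - h' 0 (idx2 n1 j) * h' 0 (idx2 n1 j) / Y).
      by move=> X Y; rewrite !mulr_suml -sumrB; apply: eq_bigr => j _; ring.
    by apply: norm_wsum_le => // j; apply: quot => //; apply: nb.
  rewrite (_ : forall a b a' b' : R, a - b - (a' - b') = (a - a') - (b - b')); last first.
    by move=> *; ring.
  apply: le_trans (ler_normB _ _) _; apply: le_trans (lerD e1 e2) _.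
  apply: (@le_trans _ _ (3 * G ^+ 4 * (1 + mass m1 m2) * d)); last by rewrite ler_wpM2r.
  rewrite -mulrDl -/(mass m1 m2).
  have := mulr_ge0 G40 d0; lra.
- move=> j; rewrite entryB !hvecE -opprD normrN; apply: le_trans K3.
  by apply: quot => //; apply: nb.
- move=> j; rewrite entryB !hvecE; apply: le_trans K3.
  by apply: quot => //; apply: nb.
Qed.

(** The hypothesis is an energy bound and not membership in the box, so that the estimate also holds
    at the final time, when the state may have left the box. *)
Lemma corrected_close {R : realType} {n1 n2 : nat} (m1 : 'I_n1 -> R)
  (m2 : 'I_n2 -> R) (G eps : R) (p u : cfg R n1 n2) :
  (forall j, 0 < m1 j) -> (forall j, 0 < m2 j) -> 1 <= G -> 0 < eps <= 1 ->
  in_phase p -> energy m1 m2 eps u <= G ^+ 2 * (1 + mass m1 m2) ->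
  `|slow eps p u - corrected m1 m2 eps p u| <= energy_cst m1 m2 G * eps /\
  `|clock m1 m2 eps p u| <= energy_cst m1 m2 G * eps.
Proof.
move=> hm1 hm2 G1 /andP[e0 e1] ph hE.
have mu0 := mass_ge0 hm1 hm2.
have [S1 Sm SV _ _] := cst_facts hm1 hm2 G1.
set S := energy_cst _ _ _ in S1 Sm SV *.
have hM : `|mom1 m1 p u| + `|mom2 m2 p u| <= S.
  by apply: le_trans (mom_le hm1 hm2 ph hE) _.
have Vle : `|cX u| <= S * eps.
  (* The bound [G * (1 + mass)] avoids a square root: its square dominates the energy bound because
     [1 + mass] is at least 1. *)
  apply: (@le_trans _ _ (eps * (G * (1 + mass m1 m2)))); last first.
    by rewrite mulrC ler_wpM2r // ltW.
  apply: (piston_speed_le hm1 hm2 e0); first by rewrite mulr_ge0 //; lra.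
  apply: le_trans hE _; rewrite exprMn ler_wpM2l ?sqr_ge0 //.
  by rewrite -[leLHS]mul1r expr2 ler_wpM2r //; lra.
have Ve r v : 0 <= r <= 1 -> `|cX u * (r * Num.sg v)| <= S * eps.
  move=> r01; apply: le_trans Vle; rewrite normrM -[leRHS]mulr1.
  by rewrite ler_wpM2l // norm_rel_sg.
split.
- apply: slow_norm_le; rewrite /slow /corrected.
  + by rewrite entryB !hvecE subrr normr0 mulr_ge0 //; lra.
  + rewrite entryB !hvecE /momW opprD addrA subrr sub0r normrN normrM (gtr0_norm e0).
    by rewrite mulrC ler_wpM2r ?(ltW e0) //; apply: le_trans (ler_normD _ _) hM.
  + move=> j; rewrite entryB !hvecE /adia1 opprB addrC subrK.
    by apply: Ve; exact: rel1_in01.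
  + move=> j; rewrite entryB !hvecE /adia2 opprB addrC subrK.
    by apply: Ve; exact: rel2_in01.
- rewrite /clock normrM ger0_norm ?sqr_ge0 // mulrC.
  apply: ler_pM => //; first exact: sqr_ge0.
    by apply: le_trans (ler_normB _ _) _; rewrite addrC.
  by rewrite expr2 ler_piMl // ltW.
Qed.

Lemma Hbar_bound {R : realType} {n1 n2 : nat} (m1 : 'I_n1 -> R) (m2 : 'I_n2 -> R)
  (G : R) (h : 'rV[R]_(2 + n1 + n2)) :
  (forall j, 0 < m1 j) -> (forall j, 0 < m2 j) -> 1 <= G -> in_box G h ->
  `|Hbar m1 m2 h| <= drift_cst m1 m2 G.
Proof.
move=> hm1 hm2 G1 [[X1 X2] W1 L1 R1].
have [S1 _ _ SK [_ K4 K3]] := cst_facts hm1 hm2 G1.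
set K := drift_cst _ _ _ in SK K4 K3 *.
have mu0 := mass_ge0 hm1 hm2.
have G0 : 0 < G by lra.
have Gi : 0 < G^-1 by rewrite invr_gt0.
have nb (x : R) : G^-1 <= x <= G -> `|x| <= G.
  by move=> /andP[? ?]; rewrite ger0_norm //; lra.
have quot (a b X : R) : `|a| <= G -> `|b| <= G -> G^-1 <= X ->
    `|a * b / X| <= G ^+ 3.
  move=> ha hb hX; have X0 : 0 < X by lra.
  rewrite normrM normfV (gtr0_norm X0) normrM.
  have -> : G ^+ 3 = G * G * G by ring.
  by rewrite ?ler_pM ?mulr_ge0 ?invr_ge0 ?(ltW X0) // -[leRHS]invrK lef_pV2 ?posrE.
have wsum (n : nat) (m s : 'I_n -> R) (X : R) : (forall j, 0 < m j) ->
    (forall j, G^-1 <= s j <= G) -> G^-1 <= X ->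
    `|(\sum_j m j * s j ^+ 2) / X| <= (\sum_j m j) * G ^+ 3.
  move=> hm hs hX.
  have -> : (\sum_j m j * s j ^+ 2) / X = \sum_j m j * (s j * s j / X).
    by rewrite mulr_suml; apply: eq_bigr => j _; ring.
  by apply: norm_wsum_le => // j; apply: quot => //; apply: nb.
apply: slow_norm_le; rewrite /Hbar ?hvecE.
- apply: le_trans W1 _; apply: le_trans K3.
  by rewrite exprS ler_peMr ?(ltW G0) // exprn_ege1.
- apply: le_trans (ler_normB _ _) _.
  apply: le_trans (lerD (wsum _ _ _ _ hm1 L1 X1) (wsum _ _ _ _ hm2 R1 X2)) _.
  rewrite -mulrDl -/(mass m1 m2); apply: le_trans K4.
  have G34 : G ^+ 3 <= G ^+ 4 by rewrite [leRHS]exprS ler_peMl ?exprn_ge0 // ltW.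
  have G30 : 0 <= G ^+ 3 by rewrite exprn_ge0 // ltW.
  have := ler_wpM2l mu0 G34; have := mulr_ge0 mu0 G30; lra.
- move=> j; rewrite hvecE normrN; apply: le_trans K3.
  by apply: quot => //; apply: nb.
- move=> j; rewrite hvecE; apply: le_trans K3.
  by apply: quot => //; apply: nb.
Qed.

(** * Drift of the corrected variables along the motion *)

(** The main terms of the exact flight identities cancel against [Hbar], whose factor is [th * eps]
    because [th] is fast time. Velocities are constant in flight, so the initial energy bound also
    controls the moments at the end. *)
Lemma drift {R : realType} {n1 n2 : nat} (m1 : 'I_n1 -> R) (m2 : 'I_n2 -> R)
  (G eps th : R) (p u : cfg R n1 n2) :
  (forall j, 0 < m1 j) -> (forall j, 0 < m2 j) -> 1 <= G -> 0 < eps <= 1 ->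
  0 <= th -> in_box G (slow eps p u) -> in_phase p -> in_phase (advance p u th) ->
  `|corrected m1 m2 eps (advance p u th) u - corrected m1 m2 eps p u
    - (th * eps) *: Hbar m1 m2 (slow eps p u)| <= drift_cst m1 m2 G * eps ^+ 2 * th /\
  `|clock m1 m2 eps (advance p u th) u - clock m1 m2 eps p u|
    <= drift_cst m1 m2 G * eps ^+ 2 * th.
Proof.
move=> hm1 hm2 G1 /andP[e0 e1] th0 hb ph ph'.
have hE := box_energy hm1 hm2 G1 hb.
have [S1 Sm _ SK [GSK _ K3]] := cst_facts hm1 hm2 G1.
have hM : `|mom1 m1 (advance p u th) u| + `|mom2 m2 (advance p u th) u|
          <= energy_cst m1 m2 G.
  by apply: le_trans (mom_le hm1 hm2 ph' hE) _.
move: hb; rewrite /slow => -[]; rewrite !hvecE => -[X1 X2] W1 L1 R1.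
set S := energy_cst _ _ _ in S1 Sm SK GSK hM.
set K := drift_cst _ _ _ in SK GSK K3 *.
clearbody K S.
have G0 : 0 < G by lra.
have Gi : 0 < G^-1 by rewrite invr_gt0.
have X0 : 0 < cX p by lra.
have Y0 : 0 < 1 - cX p by lra.
have iX : (cX p)^-1 <= G by rewrite -[leRHS]invrK lef_pV2 ?posrE.
have iY : (1 - cX p)^-1 <= G by rewrite -[leRHS]invrK lef_pV2 ?posrE.
have [/andP[X'0 X'1] _] := ph'.
have nX : cX p != 0 by rewrite gt_eqF.
have nY : 1 - cX p != 0 by rewrite gt_eqF.
have nX' : cX (advance p u th) != 0 by rewrite gt_eqF.
have nY' : 1 - cX (advance p u th) != 0 by rewrite gt_eqF // subr_gt0.
have ne : eps != 0 by rewrite gt_eqF.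
have VG : `|cX u| <= eps * G.
  by move: W1; rewrite normrM normfV (gtr0_norm e0) ler_pdivrMr // mulrC.
have e20 : 0 <= eps ^+ 2 by exact: sqr_ge0.
have VX : `|cX u / cX p| <= eps * G ^+ 2.
  rewrite normrM normfV (gtr0_norm X0) expr2 mulrA.
  by rewrite ler_pM // invr_ge0 ltW.
have VY : `|cX u / (1 - cX p)| <= eps * G ^+ 2.
  rewrite normrM normfV (gtr0_norm Y0) expr2 mulrA.
  by rewrite ler_pM // invr_ge0 ltW.
set a := cX u / cX p in VX; set b := cX u / (1 - cX p) in VY.
set M1 := mom1 _ (advance _ _ _) _ in hM.
set M2 := mom2 _ (advance _ _ _) _ in hM.
have abM : `|a * M1| + `|b * M2| <= eps * (G ^+ 2 * S).
  rewrite (normrM a) (normrM b).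
  apply: le_trans (lerD (ler_wpM2r (normr_ge0 M1) VX) (ler_wpM2r (normr_ge0 M2) VY)) _.
  by rewrite -mulrDr mulrA ler_wpM2l // mulr_ge0 ?sqr_ge0 // ltW.
have G2SK : G ^+ 2 * S <= K.
  by have := mulr_ge0 (ltW G0) (le_trans ler01 S1); lra.
have K0 : 0 <= K by lra.
have sg_bd (Y r v : R) : `|cX u / Y| <= eps * G ^+ 2 -> 0 <= r <= 1 ->
    `|th * (cX u ^+ 2 / Y * (r * Num.sg v))| <= K * eps ^+ 2 * th.
  move=> hY r01; rewrite normrM (ger0_norm th0) mulrC ler_wpM2r //.
  have -> : cX u ^+ 2 / Y * (r * Num.sg v) = cX u * (cX u / Y) * (r * Num.sg v).
    by ring.
  rewrite normrM -[leRHS]mulr1 ler_pM ?norm_rel_sg // normrM.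
  apply: le_trans (ler_pM (normr_ge0 _) (normr_ge0 _) VG hY) _.
  have -> : eps * G * (eps * G ^+ 2) = G ^+ 3 * eps ^+ 2 by ring.
  by rewrite ler_wpM2r.
split.
- apply: slow_norm_le.
  + rewrite 2!entryB entryZ /Hbar /slow /corrected !hvecE /=.
    rewrite (_ : _ - _ = 0) ?normr0; first by rewrite 2?mulr_ge0.
    by field.
  + rewrite 2!entryB entryZ /Hbar /slow /corrected !hvecE /momW.
    under eq_bigr do rewrite hvecE.
    under [X in _ / _ - X / _]eq_bigr do rewrite hvecE.
    rewrite (@mom1_advance _ _ _ m1) // (@mom2_advance _ _ _ m2) // -/M1 -/M2 -/a -/b.
    (* The pressures [A1] and [A2] cancel; what is left has a further factor [eps] from [a] and
       [b]. *)
    set A1 := _ / cX p; set A2 := _ / (1 - cX p).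
    rewrite (_ : _ - _ = eps * th * (b * M2 - a * M1)); last by ring.
    rewrite normrM (ger0_norm (_ : 0 <= eps * th)) ?mulr_ge0 ?(ltW e0) //.
    have : `|b * M2 - a * M1| <= eps * K.
      apply: le_trans (ler_normB _ _) _; rewrite addrC; apply: le_trans abM _.
      by rewrite ler_wpM2l // ltW.
    move=> /(ler_wpM2l (_ : 0 <= eps * th)); rewrite mulr_ge0 ?(ltW e0) // => /(_ isT).
    by move=> h; apply: le_trans h _; rewrite le_eqVlt; apply/orP; left; apply/eqP; ring.
  + move=> j; rewrite 2!entryB entryZ /Hbar /slow /corrected !hvecE.
    rewrite adia1_advance //.
    have := sg_bd (cX p) _ (c1 u j) VX (rel1_in01 j ph').
    by congr (`|_| <= _); field; rewrite nX.
  + move=> j; rewrite 2!entryB entryZ /Hbar /slow /corrected !hvecE.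
    rewrite adia2_advance //.
    have := sg_bd (1 - cX p) _ (c2 u j) VY (rel2_in01 j ph').
    rewrite -normrN; congr (`|_| <= _); field.
    by rewrite nY.
- rewrite /clock (@mom1_advance _ _ _ m1) // (@mom2_advance _ _ _ m2) //.
  rewrite -/M1 -/M2 -/a -/b.
  (* No cancellation here: the pressures stay, but the clock already has the factor [eps ^+ 2]. *)
  set A1 := _ / cX p; set A2 := _ / (1 - cX p).
  rewrite (_ : _ - _ = eps ^+ 2 * th * (b * M2 + a * M1 - A1 - A2)); last by ring.
  have et0 : 0 <= eps ^+ 2 * th by rewrite mulr_ge0.
  rewrite normrM (ger0_norm et0).
  rewrite -[leRHS]mulrA mulrC.
  suff H : `|b * M2 + a * M1 - A1 - A2| <= K by rewrite ler_wpM2r.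
  have s1 : 0 <= \sum_j m1 j * `|c1 u j| ^+ 2.
    by apply: sumr_ge0 => j _; rewrite mulr_ge0 ?sqr_ge0 // ltW.
  have s2 : 0 <= \sum_j m2 j * `|c2 u j| ^+ 2.
    by apply: sumr_ge0 => j _; rewrite mulr_ge0 ?sqr_ge0 // ltW.
  have hA1 : `|A1| <= (\sum_j m1 j * `|c1 u j| ^+ 2) * G.
    rewrite /A1 normrM (ger0_norm s1) normfV (gtr0_norm X0).
    by rewrite ler_wpM2l.
  have hA2 : `|A2| <= (\sum_j m2 j * `|c2 u j| ^+ 2) * G.
    rewrite /A2 normrM (ger0_norm s2) normfV (gtr0_norm Y0).
    by rewrite ler_wpM2l.
  have hA : `|A1| + `|A2| <= G * S.
    apply: le_trans (lerD hA1 hA2) _; rewrite -mulrDl mulrC ler_wpM2l ?(ltW G0) //.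
    have := mass_ge0 hm1 hm2; move: hE Sm; rewrite /energy.
    under eq_bigr do rewrite -real_normK ?num_real //.
    under [X in _ + _ + X]eq_bigr do rewrite -real_normK ?num_real //.
    by have := sqr_ge0 (cX u / eps); lra.
  apply: (@le_trans _ _ (`|a * M1| + `|b * M2| + (`|A1| + `|A2|))).
    apply: le_trans (ler_normB _ _) _; rewrite addrA lerD2r.
    apply: le_trans (ler_normB _ _) _; rewrite lerD2r.
    by apply: le_trans (ler_normD _ _) _; rewrite addrC.
  have : eps * (G ^+ 2 * S) <= G ^+ 2 * S.
    by rewrite ler_piMl // mulr_ge0 ?sqr_ge0 //; lra.
  lra.
Qed.

Lemma advanceK {R : realType} {n1 n2 : nat} (p u : cfg R n1 n2) (th : R) :
  advance (advance p u th) u (- th) = p.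
Proof.
by case: p => X x1 x2; rewrite /advance /=; congr Cfg;
  [|apply/funext => j|apply/funext => j]; rewrite mulNr addrK.
Qed.

(** Just after [a] the motion is free flight with velocity [vel a], whatever collisions took place
    at [a]. *)
Lemma motion_right {R : realType} {n1 n2 : nat} (m1 : 'I_n1 -> R) (m2 : 'I_n2 -> R)
  (G eps a tmax : R) (x0 u0 : cfg R n1 n2) (pos vel : R -> cfg R n1 n2) :
  (forall j, 0 < m1 j) -> (forall j, 0 < m2 j) -> 1 <= G -> 0 < eps <= 1 ->
  is_motion m1 m2 (eps ^- 2) x0 u0 tmax pos vel -> 0 <= a < tmax ->
  in_box G (slow eps (pos a) (vel a)) ->
  exists2 d, 0 < d & forall s, a <= s < a + d -> s < tmax ->
    `|corrected m1 m2 eps (pos s) (vel s) - corrected m1 m2 eps (pos a) (vel a)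
      - ((s - a) * eps) *: Hbar m1 m2 (slow eps (pos a) (vel a))|
      <= drift_cst m1 m2 G * eps ^+ 2 * (s - a) /\
    `|clock m1 m2 eps (pos s) (vel s) - clock m1 m2 eps (pos a) (vel a)|
      <= drift_cst m1 m2 G * eps ^+ 2 * (s - a).
Proof.
move=> hm1 hm2 G1 e01 [_ mo] a_lt hb.
have [pha [d [d0 [w [_ [_ [_ mr]]]]]]] := mo a a_lt.
exists d => // s asd st; have [-> ps] := mr s asd st.
case/andP: asd a_lt => as_ _ /andP[a0 _].
have [|phs _] := mo s; first by rewrite st andbT; lra.
by rewrite ps in phs *; apply: drift => //; lra.
Qed.

(** Free flight with the left-limit velocity [w], followed by the collisions at [a]. The box just
    before [a] gives [w] its energy and speed bounds, and the smallness of [eps] keeps the piston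
    below a quarter of the least gas speed. *)
Lemma motion_left {R : realType} {n1 n2 : nat} (m1 : 'I_n1 -> R) (m2 : 'I_n2 -> R)
  (G eps a tmax : R) (x0 u0 : cfg R n1 n2) (pos vel : R -> cfg R n1 n2) :
  (forall j, 0 < m1 j) -> (forall j, 0 < m2 j) -> 1 <= G -> 0 < eps <= 1 ->
  4 * (eps * (G * (1 + mass m1 m2))) <= G^-1 ->
  is_motion m1 m2 (eps ^- 2) x0 u0 tmax pos vel -> 0 < a < tmax ->
  (forall s, 0 <= s < a -> in_box G (slow eps (pos s) (vel s))) ->
  energy m1 m2 eps (vel a) <= G ^+ 2 * (1 + mass m1 m2) /\
  exists2 d, 0 < d & forall s, a - d < s < a -> 0 <= s ->
    `|corrected m1 m2 eps (pos a) (vel a) - corrected m1 m2 eps (pos s) (vel s)|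
      <= clock m1 m2 eps (pos a) (vel a) - clock m1 m2 eps (pos s) (vel s)
         + 3 * drift_cst m1 m2 G * (a - s).
Proof.
move=> hm1 hm2 G1 e01 ge [_ mo] /andP[a0 at_] hb.
have [e0 e1] := andP e01.
have Gi : 0 < G^-1 by rewrite invr_gt0; lra.
have mu0 := mass_ge0 hm1 hm2.
have [pha [d [d0 [w [_ [rs [ml _]]]]]]] := mo a (ssrbool.introT andP (conj (ltW a0) at_)).
(* A nonnegative time close enough to [a] that the velocity is already [w]. *)
have [s0 [s00 s0a s0d]] : exists s0, [/\ 0 <= s0, s0 < a & a - d < s0].
  exists (Num.max (a / 2) (a - d / 2)); rewrite le_max gt_max lt_max.
  by split; [apply/orP; left|apply/andP; split|apply/orP; right]; lra.
have hE : energy m1 m2 eps w <= G ^+ 2 * (1 + mass m1 m2).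
  have [<- _] := ml s0 (ssrbool.introT andP (conj s0d s0a)) s00.
  by apply: (box_energy hm1 hm2 G1 (p := pos s0)); apply: hb; rewrite s00.
have [wl1 wl2] : (forall j, G^-1 <= `|c1 w j|) /\ (forall j, G^-1 <= `|c2 w j|).
  have [<- _] := ml s0 (ssrbool.introT andP (conj s0d s0a)) s00.
  have [] := hb s0 (ssrbool.introT andP (conj s00 s0a)).
  rewrite /slow !hvecE => _ _ h1 h2; split=> j.
    by have := h1 j; rewrite hvecE => /andP[].
  by have := h2 j; rewrite hvecE => /andP[].
have en u : energy m1 m2 eps u = energy m1 m2 eps w ->
    `|cX u| <= eps * (G * (1 + mass m1 m2)).
  move=> uw; apply: (piston_speed_le hm1 hm2 e0); first by rewrite mulr_ge0; lra.
  rewrite uw; apply: le_trans hE _; rewrite exprMn ler_wpM2l ?sqr_ge0 //.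
  by rewrite -[leLHS]mul1r expr2 ler_wpM2r //; lra.
have [Eu Cu] := resolve_corrected hm1 hm2 e0 Gi ge pha en wl1 wl2 rs.
split; first by rewrite Eu.
exists d => // s sd s_ge0; have [vs ps] := ml s sd s_ge0.
have sa : s < a by case/andP: sd.
have hbs := hb s (ssrbool.introT andP (conj s_ge0 sa)).
have [|phs _] := mo s; first by rewrite s_ge0 (lt_trans sa).
have pa : pos a = advance (pos s) w (a - s) by rewrite ps -[a - s]opprB advanceK.
have as0 : 0 <= a - s by lra.
have pha' : in_phase (advance (pos s) w (a - s)) by rewrite -pa.
rewrite vs in hbs *.
have [] := drift hm1 hm2 G1 e01 as0 hbs phs pha'; rewrite -pa.
have := Hbar_bound hm1 hm2 G1 hbs.
set K := drift_cst _ _ _; set H := Hbar _ _ _; set ca := corrected _ _ _ (pos a) w.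
set cs := corrected _ _ _ _ w; set ka := clock _ _ _ (pos a) w.
set ks := clock _ _ _ _ w => HK D1 /ler_normlP[D2 _].
have K0 : 0 <= K by exact: le_trans (normr_ge0 _) HK.
have H1 : `|((a - s) * eps) *: H| <= K * (a - s).
  rewrite normrZ (ger0_norm (_ : 0 <= (a - s) * eps)) ?mulr_ge0 ?(ltW e0) //.
  rewrite mulrC ler_pM ?mulr_ge0 ?(ltW e0) //.
  by rewrite ler_piMr.
have e2 : K * eps ^+ 2 * (a - s) <= K * (a - s).
  by rewrite ler_wpM2r // ler_piMr // expr_le1 // ltW.
(* Separates the jump at [a] from the flight. Of the three multiples of [K * (a - s)], one is the
   flight error, one the drift along [Hbar], and one the drift of the clock before the jump. *)
have -> : corrected m1 m2 eps (pos a) (vel a) - cs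
        = (corrected m1 m2 eps (pos a) (vel a) - ca)
          + ((ca - cs - ((a - s) * eps) *: H) + ((a - s) * eps) *: H).
  by rewrite subrK addrA subrK.
apply: le_trans (ler_normD _ _) _.
have := ler_normD (ca - cs - ((a - s) * eps) *: H) (((a - s) * eps) *: H).
rewrite -/ca -/ka in Cu; lra.
Qed.

(** * The averaging estimate in slow time *)

(** The box is assumed only strictly before [tau], so the estimate includes the instant at which the
    compact set is left. *)
Lemma averaging {R : realType} {n1 n2 : nat} (m1 : 'I_n1 -> R) (m2 : 'I_n2 -> R)
  (G eps tmax tau taumax : R) (x0 u0 : cfg R n1 n2) (pos vel : R -> cfg R n1 n2)
  (hbar : R -> 'rV[R]_(2 + n1 + n2)) :
  (forall j, 0 < m1 j) -> (forall j, 0 < m2 j) -> 1 <= G -> 0 < eps <= 1 ->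
  4 * (eps * (G * (1 + mass m1 m2))) <= G^-1 ->
  is_motion m1 m2 (eps ^- 2) x0 u0 tmax pos vel ->
  hbar 0 = slow eps (pos 0) (vel 0) ->
  {within `[0, taumax[, continuous hbar} ->
  (forall t, 0 < t < taumax -> is_derive t 1 hbar (Hbar m1 m2 (hbar t))) ->
  0 < tau -> tau < taumax -> tau / eps < tmax ->
  (forall t, 0 <= t < tau ->
     in_box G (hbar t) /\ in_box G (slow eps (pos (t / eps)) (vel (t / eps)))) ->
  `|slow eps (pos (tau / eps)) (vel (tau / eps)) - hbar tau|
    <= (4 * energy_cst m1 m2 G + 2) * expR (drift_cst m1 m2 G * tau) * eps.
Proof.
move=> hm1 hm2 G1 e01 ge mo h0 hc hd t0 tt ttm hb.
have [e0 e1] := andP e01.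
have mu0 := mass_ge0 hm1 hm2.
have [S1 Sm SV SK _] := cst_facts hm1 hm2 G1.
set S := energy_cst _ _ _ in S1 Sm SV SK *.
set K := drift_cst _ _ _ in SK *.
(* From here on [t] is slow time; the change of time turns drift errors of order [eps ^+ 2] into
   order [eps]. *)
pose p t := pos (t / eps); pose u t := vel (t / eps).
pose c t := corrected m1 m2 eps (p t) (u t).
pose k t := clock m1 m2 eps (p t) (u t).
have t_eps t : 0 <= t -> 0 <= t / eps by move=> ?; rewrite divr_ge0 // ltW.
have ph t : 0 <= t <= tau -> in_phase (p t).
  move=> /andP[t1 t2]; have [|//] := mo.2 (t / eps); rewrite t_eps //=.
  by apply: le_lt_trans ttm; rewrite ler_pM2r // invr_gt0.
have boxr s : 0 <= s < tau / eps -> in_box G (slow eps (pos s) (vel s)).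
  move=> /andP[s0 st]; have [|_] := hb (s * eps); last by rewrite mulfK // gt_eqF.
  by rewrite mulr_ge0 ?(ltW e0) // -ltr_pdivlMr.
have left_ t : 0 < t <= tau ->
    energy m1 m2 eps (u t) <= G ^+ 2 * (1 + mass m1 m2) /\
    exists2 d, 0 < d & forall s, t - d < s < t -> 0 <= s ->
      `|c t - c s| <= k t - k s + 3 * K * ((t - s) / eps).
  move=> /andP[t1 t2].
  have te : 0 < t / eps by rewrite divr_gt0.
  have tte : t / eps <= tau / eps by rewrite ler_pM2r // invr_gt0.
  have [||E [d d0 H]] := @motion_left _ _ _ m1 m2 G eps (t / eps) tmax x0 u0 pos vel
    hm1 hm2 G1 e01 ge mo.
  - by rewrite te (le_lt_trans tte).
  - by move=> s /andP[s0 st]; apply: boxr; rewrite s0 (lt_le_trans st).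
  split=> //; exists (d * eps); first by rewrite mulr_gt0.
  move=> s /andP[sd st] s0; rewrite mulrBl; apply: H; last exact: t_eps.
  rewrite ltr_pM2r ?invr_gt0 // st andbT ltr_pdivlMr // mulrBl divfK ?gt_eqF //.
have close t : 0 <= t <= tau ->
    `|slow eps (p t) (u t) - c t| <= S * eps /\ `|k t| <= S * eps.
  move=> tr; apply: corrected_close => //; first exact: ph.
  case/andP: tr => t1 t2; have [t1'|t1'] := ltP 0 t.
    by have [|] := left_ t; rewrite ?t1'.
  have -> : t = 0 by apply/eqP; rewrite eq_le t1 t1'.
  by have [|_ /(box_energy hm1 hm2 G1)] := hb 0; rewrite ?lexx.
have right_ t : 0 <= t < tau -> exists2 d, 0 < d & forall s, t <= s < t + d ->
    s <= tau ->
    `|c s - c t - (s - t) *: Hbar m1 m2 (slow eps (p t) (u t))| <= K * eps * (s - t)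
    /\ `|k s - k t| <= K * eps * (s - t).
  move=> tr; have [_ hbt] := hb t tr; case/andP: tr => t1 t2.
  have [|d d0 H] := motion_right hm1 hm2 G1 e01 mo (a := t / eps) _ hbt.
    by rewrite t_eps //= (lt_trans _ ttm) // ltr_pM2r // invr_gt0.
  exists (d * eps); first by rewrite mulr_gt0.
  move=> s /andP[ts sd] st.
  have [||] := H (s / eps).
  - rewrite ler_pM2r ?invr_gt0 // ts /= ltr_pdivrMr // mulrDl divfK ?gt_eqF //.
  - by apply: le_lt_trans ttm; rewrite ler_pM2r // invr_gt0.
  have -> : (s / eps - t / eps) * eps = s - t by field; rewrite gt_eqF.
  have -> // : drift_cst m1 m2 G * eps ^+ 2 * (s / eps - t / eps) = K * eps * (s - t).
  by rewrite /K; field; rewrite gt_eqF.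
have Hle t : 0 <= t < tau -> `|Hbar m1 m2 (slow eps (p t) (u t))| <= K.
  by move=> /hb[_ /(Hbar_bound hm1 hm2 G1)].
have Hlip t : 0 <= t < tau ->
    `|Hbar m1 m2 (slow eps (p t) (u t)) - Hbar m1 m2 (hbar t)|
      <= K * `|slow eps (p t) (u t) - hbar t|.
  by move=> /hb[b1 b2]; exact: Hbar_lip.
clearbody K S.
have K0 : 0 < K by lra.
have Se0 : 0 <= S * eps by rewrite mulr_ge0 //; lra.
(* Subtracting the clock absorbs the jumps of [c]; the constant turns the
   O(eps) errors of the right derivative into a multiple of [f]. *)
pose f t := `|c t - hbar t| - k t + (2 * S + 2) * eps.
(* Of the added constant, [2 * S * eps] pays for the correction and for the clock; the remaining
   [2 * eps] is kept as a reserve. *)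
have fE t : 0 <= t <= tau ->
    `|slow eps (p t) (u t) - hbar t| <= f t - 2 * eps.
  move=> tr; have [C1 /ler_normlP[_ C2]] := close t tr.
  have -> : slow eps (p t) (u t) - hbar t
            = (slow eps (p t) (u t) - c t) + (c t - hbar t) by rewrite addrA subrK.
  by apply: le_trans (ler_normD _ _) _; rewrite /f; lra.
have f0 : 0 <= f 0 <= (4 * S + 2) * eps.
  have [|] := close 0; first by rewrite lexx ltW.
  rewrite {1}/p {1}/u mul0r -h0 distrC => C1 /ler_normlP[C2 C3].
  by rewrite /f; have := normr_ge0 (c 0 - hbar 0); lra.
suff H : f tau <= f 0 * expR (K * tau).
  have tr : 0 <= tau <= tau by rewrite lexx ltW.
  apply: le_trans (fE tau tr) _.
  have E0 := expR_ge0 (K * tau).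
  case/andP: f0 => _ /(ler_wpM2r E0); lra.
apply: dini_gronwall; rewrite ?(ltW K0) ?(ltW t0) //; first by case/andP: f0.
(* At 0 only continuity of [hbar] is available and takes [eta / 2]; the flight error, the drift
   along [Hbar] and the clock take at most [eta / 6] each. *)
- move=> eta eta0.
  have r0 : 0 <= (0 : R) < tau by rewrite t0 lexx.
  have [d1 d10 H1] := right_ 0 r0.
  have rm : 0 <= (0 : R) < taumax by rewrite lexx (lt_trans t0).
  have [d2 d20 H2] := within_continuous_estimate hc rm (divr_gt0 eta0 (ltr0n R 2)).
  have KK : 0 < 6 * K by lra.
  exists (Num.min (Num.min d1 d2) (eta / (6 * K))).
    by rewrite !lt_min d10 d20 divr_gt0.
  move=> s; rewrite !lt_min => /andP[s0 /andP[/andP[sd1 sd2]]].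
  rewrite ltr_pdivlMr // => sd3 st.
  have [|C1 /ler_normlP[C2 _]] := H1 s _ st; first by rewrite ltW ?add0r.
  rewrite !subr0 in C1 C2.
  have {}H2 : `|hbar s - hbar 0| <= eta / 2.
    apply: H2; first by rewrite ltW //= (le_lt_trans st).
    by rewrite subr0 gtr0_norm.
  have HK : `|s *: Hbar m1 m2 (slow eps (p 0) (u 0))| <= s * K.
    by rewrite normrZ gtr0_norm // ler_wpM2l ?Hle // ltW.
  have e2 : K * eps * s <= K * s by rewrite ler_wpM2r ?(ltW s0) // ler_piMr // ltW.
  set H := Hbar _ _ _ in C1 HK.
  have E1 : c s - hbar s = (c s - c 0 - s *: H) + s *: H + (c 0 - hbar 0)
                           - (hbar s - hbar 0).
    by rewrite subrK addrA subrK opprB addrA subrK.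
  have := ler_normB ((c s - c 0 - s *: H) + s *: H + (c 0 - hbar 0)) (hbar s - hbar 0).
  have := ler_normD ((c s - c 0 - s *: H) + s *: H) (c 0 - hbar 0).
  have := ler_normD (c s - c 0 - s *: H) (s *: H).
  rewrite -E1 /f; lra.
- move=> t tr eta eta0; case/andP: (tr) => t_gt0 t_lt.
  have r0 : 0 <= t < tau by rewrite ltW.
  have [d1 d10 H1] := right_ t r0.
  have rm : 0 < t < taumax by rewrite t_gt0 (lt_trans t_lt).
  have [d2 d20 H2] := is_derive_estimate (hd t rm) eta0.
  exists (Num.min d1 d2); first by rewrite lt_min d10.
  move=> s /andP[ts sd] st.
  have [sd1 sd2] : s < t + d1 /\ s < t + d2.
    by move: sd; rewrite -!ltrBlDl lt_min => /andP[].
  have [|C1 /ler_normlP[C2 _]] := H1 s _ st; first by rewrite ltW.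
  have st0 : 0 < s - t by rewrite subr_gt0.
  have {}H2 := H2 s; rewrite (gtr0_norm st0) in H2.
  have {}H2 := H2 (_ : s - t < d2); rewrite ltrBlDl in H2.
  have {}H2 := H2 sd2.
  have HL := Hlip t r0.
  have tr' : 0 <= t <= tau by rewrite !ltW.
  (* The reserve gives [- 2 * K * eps], which cancels the drift errors of [c] and of the clock, so
     that the Dini derivative is at most [K * f t]. *)
  have fE' := ler_wpM2l (ltW K0) (fE t tr').
  set H := Hbar _ _ _ in C1 HL; set H' := Hbar _ _ _ in HL H2.
  have HLs : `|(s - t) *: (H - H')| <= (s - t) * (K * (f t - 2 * eps)).
    by rewrite normrZ gtr0_norm // ler_wpM2l ?(ltW st0) // (le_trans HL).
  have E1 : c s - hbar s = (c s - c t - (s - t) *: H) + (s - t) *: (H - H')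
                 + (c t - hbar t) - (hbar s - hbar t - (s - t) *: H').
    rewrite scalerBr; move: (c s) (c t) (hbar s) (hbar t) (_ *: H) (_ *: H').
    by move=> a b x y v v'; apply/rowP => i; rewrite !mxE; ring.
  have := ler_normB ((c s - c t - (s - t) *: H) + (s - t) *: (H - H') + (c t - hbar t))
            (hbar s - hbar t - (s - t) *: H').
  have := ler_normD ((c s - c t - (s - t) *: H) + (s - t) *: (H - H')) (c t - hbar t).
  have := ler_normD (c s - c t - (s - t) *: H) ((s - t) *: (H - H')).
  rewrite -E1 /f; rewrite /f in HLs; lra.
(* A jump of [c] at [t] is compensated by the clock; what remains tends to 0 as the comparison time
   [t - d / 2] approaches [t]. *)
- move=> t tr eta eta0; case/andP: (tr) => t_gt0 t_le.
  have [_ [d1 d10 H1]] := left_ t tr.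
  have rm : 0 <= t < taumax by rewrite ltW //= (le_lt_trans t_le).
  have [d2 d20 H2] := within_continuous_estimate hc rm (divr_gt0 eta0 (ltr0n R 2)).
  have KK : 0 < 6 * K / eps by rewrite divr_gt0 //; lra.
  pose d := Num.min (Num.min d1 d2) (Num.min t (eta / (6 * K / eps))).
  have d0 : 0 < d by rewrite !lt_min d10 d20 t_gt0 divr_gt0.
  have [dd1 dd2 dt de] : [/\ d <= d1, d <= d2, d <= t & d <= eta / (6 * K / eps)].
    by split; rewrite /d !ge_min lexx ?orbT.
  rewrite ler_pdivlMr // in de.
  clearbody d.
  exists (t - d / 2); first by apply/andP; split; lra.
  have s0 : 0 <= t - d / 2 by lra.
  have st : t - d1 < t - d / 2 < t by apply/andP; split; lra.
  have {H1} := H1 _ st s0.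
  have {H2} : `|hbar (t - d / 2) - hbar t| <= eta / 2.
    apply: H2; first by rewrite s0; lra.
    by rewrite (_ : _ - t = - (d / 2)) ?normrN ?gtr0_norm; lra.
  set s := t - d / 2 => H2 H1.
  have E1 : c t - hbar t = (c t - c s) + (c s - hbar s) + (hbar s - hbar t).
    by rewrite !subrKA.
  have := ler_normD ((c t - c s) + (c s - hbar s)) (hbar s - hbar t).
  have := ler_normD (c t - c s) (c s - hbar s).
  have e2 : 3 * K * ((t - s) / eps) <= eta / 2.
    by rewrite (_ : 3 * K * _ = d * (6 * K / eps) / 4) /s; [lra|field; rewrite gt_eqF].
  rewrite -E1 /f; lra.
Qed.

(** * Constants uniform over the compact sets *)

Theorem theorem1 (R : realType) (n1 n2 : nat) (hn1 : (0 < n1)%N) (hn2 : (0 < n2)%N)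
  (m1 : 'I_n1 -> R) (m2 : 'I_n2 -> R)
  (hm1 : forall j, 0 < m1 j) (hm2 : forall j, 0 < m2 j)
  (A B C : set R) (cA : compact A) (cB : compact B) (cC : compact C)
  (hA : forall x, A x -> 0 < x < 1) (hC : forall x, C x -> 0 < x)
  (Vs : set 'rV[R]_(2 + n1 + n2)) (cV : compact Vs)
  (hV : forall h, Vs h ->
     [/\ A (h 0 (idxX n1 n2)), B (h 0 (idxW n1 n2)),
         (forall j, C (h 0 (idx1 n2 j))) & (forall j, C (h 0 (idx2 n1 j)))])
  (T : R) (hT : 0 < T) :
  exists K : R, 0 < K /\ exists eps0 : R, 0 < eps0 /\
  forall eps : R, 0 < eps <= eps0 ->
  forall (x0 u0 : cfg R n1 n2) (tmax : R) (pos vel : R -> cfg R n1 n2),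
    in_phase x0 ->
    0 < tmax ->
    is_motion m1 m2 (eps ^- 2) x0 u0 tmax pos vel ->
    let heps := fun t => slow eps (pos t) (vel t) in
    Vs (heps 0) ->
  forall (taumax : R) (hbar : R -> 'rV[R]_(2 + n1 + n2)),
    0 < taumax ->
    hbar 0 = heps 0 ->
    {within `[0, taumax[, continuous hbar} ->
    (forall tau, 0 < tau < taumax -> is_derive tau 1 hbar (Hbar m1 m2 (hbar tau))) ->
  forall tau : R, 0 <= tau <= T -> tau < taumax -> tau / eps < tmax ->
    (forall sigma, 0 <= sigma < tau -> Vs (hbar sigma) /\ Vs (heps (sigma / eps))) ->
    `| heps (tau / eps) - hbar tau | <= K * eps.

Proof.
have [G1 G1_ge A1] : exists2 G, 1 <= G & forall x, A x -> G^-1 <= x.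
  apply: (@compact_pos_bound _ _ id) => // [x|x /hA/andP[]//]; exact: cvg_id.
have [G2 G2_ge A2] : exists2 G, 1 <= G & forall x, A x -> G^-1 <= 1 - x.
  apply: (@compact_pos_bound _ _ (fun x => 1 - x)) => // [x|x /hA/andP[_]].
    by apply: cvgB; [exact: cvg_cst|exact: cvg_id].
  by rewrite subr_gt0.
have [G3 G3_ge B1] := compact_bound cB.
have [G4 G4_ge C1] := compact_bound cC.
have [G5 G5_ge C2] : exists2 G, 1 <= G & forall x, C x -> G^-1 <= x.
  by apply: (@compact_pos_bound _ _ id) => // x; exact: cvg_id.
(* All summands are at least 1, so the sum dominates each of them. *)
pose G := G1 + G2 + G3 + G4 + G5.
have G_ge : 1 <= G by rewrite /G; lra.
have Gi H x : 1 <= H -> H <= G -> H^-1 <= x -> G^-1 <= x.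
  by move=> H1 HG; apply: le_trans; rewrite lef_pV2 ?posrE; lra.
have box h : Vs h -> in_box G h.
  move=> /hV[hx hw h1 h2]; split.
  - split; [apply: (Gi G1) => //|apply: (Gi G2) => //]; try exact: A1; try exact: A2;
      rewrite /G; lra.
  - by apply: le_trans (B1 _ hw) _; rewrite /G; lra.
  - move=> j; apply/andP; split.
      by apply: (Gi G5) (C2 _ (h1 j)); rewrite // /G; lra.
    by apply: le_trans (ler_norm _) _; apply: le_trans (C1 _ (h1 j)) _; rewrite /G; lra.
  - move=> j; apply/andP; split.
      by apply: (Gi G5) (C2 _ (h2 j)); rewrite // /G; lra.
    by apply: le_trans (ler_norm _) _; apply: le_trans (C1 _ (h2 j)) _; rewrite /G; lra.
have [S1 _ _ SK _] := cst_facts hm1 hm2 G_ge.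
have mu0 := mass_ge0 hm1 hm2.
set S := energy_cst m1 m2 G in S1 SK.
set K := drift_cst m1 m2 G in SK.
have K0 : 0 <= K by lra.
have V0 : 1 <= 4 * (G * (1 + mass m1 m2)) * G.
  have : 1 <= G * G by rewrite -expr2 exprn_ege1.
  have := mulr_ge0 mu0 (sqr_ge0 G); rewrite expr2; lra.
have V0' : 0 < 4 * (G * (1 + mass m1 m2)) * G by lra.
exists ((4 * S + 2) * expR (K * T)); split.
  by rewrite mulr_gt0 ?expR_gt0 //; lra.
(* Exactly the threshold below which the piston speed bound is at most a quarter of [G^-1]; by [V0]
   it is at most 1. *)
exists (4 * (G * (1 + mass m1 m2)) * G)^-1; split; first by rewrite invr_gt0.
move=> eps /andP[e0 ele] x0 u0 tmax pos vel ph0 tm0 mo heps hV0.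
move=> taumax hbar tx0 h0 hc hd tau /andP[t0 tT] ttx ttm hVs.
have e1 : eps <= 1 by apply: le_trans ele _; rewrite invf_le1.
(* At [tau = 0] the two sides start equal, and no box membership is available from the empty range
   of [sigma]. *)
have [t_gt0|t_le0] := ltP 0 tau; last first.
  have -> : tau = 0 by apply/eqP; rewrite eq_le t_le0 t0.
  rewrite mul0r h0 subrr normr0 !mulr_ge0 ?expR_ge0 ?(ltW e0) //; lra.
apply: (@le_trans _ _ ((4 * S + 2) * expR (K * tau) * eps)).
  apply: (averaging hm1 hm2 G_ge _ _ mo) => //.
  - by rewrite e0.
  - have Gp : 0 < G by lra.
    rewrite -[G^-1]mul1r ler_pdivlMr //.
    move: ele; rewrite -[X in _ <= X]mul1r ler_pdivlMr //; lra.
  - by move=> t /hVs[v1 v2]; split; exact: box.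
rewrite ler_wpM2r ?(ltW e0) // ler_wpM2l ?ler_expR ?ler_wpM2l //; lra.
Qed.
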